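(* The homomorphism $\hat\omega:\mathscr{P}^{S_\infty}(\mathbb{Z})\to\mathscr{P}^{S_\infty}(\mathbb{Z})$ defined by $\hat\omega(e_n)=h_n$ ($n\ge1$) and $\hat\omega(\tilde e_n)=\tilde h_n$ ($n\ge0$) is an involution, i.e. $\hat\omega^2=1$. Equivalently, $\hat\omega(h_n)=e_n$ and $\hat\omega(\tilde h_n)=\tilde e_n$ for all $n$.
   Context: Let $x_1,x_2,\dots$ be commuting variables and $\theta_1,\theta_2,\dots$ anticommuting variables ($\theta_i\theta_j=-\theta_j\theta_i$, $\theta_i^2=0$) commuting with the $x_i$. $\mathscr{P}^{S_\infty}(\mathbb{Z})$ is the ring of formal series of bounded degree with integer coefficients in $(x,\theta)$ invariant under simultaneous permutations of the pairs $(x_i,\theta_i)$. Elements $e_n,\tilde e_n,h_n,\tilde h_n$ of this ring are defined by $$\sum_{n\ge0}t^n(e_n+\tau\tilde e_n)=\prod_{i\ge1}(1+tx_i+\tau\theta_i),\qquad \sum_{n\ge0}t^n(h_n+\tau\tilde h_n)=\prod_{i\ge1}\frac1{1-tx_i-\tau\theta_i},$$ where $t$ is a commuting parameter and $\tau$ an anticommuting parameter (anticommuting also with the $\theta_i$). The ring $\mathscr{P}^{S_\infty}(\mathbb{Z})$ is freely generated, as a supercommutative ring, by the even elements $e_n$ ($n\ge1$) and the odd elements $\tilde e_n$ ($n\ge0$), so $\hat\omega$ is well defined as a ring homomorphism. *)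

(* Defs.v *)
From HB Require Import structures.
From mathcomp Require Import all_boot all_order all_algebra.
From mathcomp Require Import finmap multiset boolp zify ring.

Set Implicit Arguments.
Unset Strict Implicit.
Unset Printing Implicit Defensive.

Import GRing.Theory.

Local Open Scope mset_scope.

(* (a, I) stands for the monomial x^a theta_I, where x^a is the product of the
   x_i over the multiset a and theta_I is the product of the theta_i, i in I,
   taken in increasing order of the indices. *)
Definition supermon := ({mset nat} * {fset nat})%type.
HB.instance Definition _ := Choice.copy supermon ({mset nat} * {fset nat})%type.

Section Monomials.
Local Open Scope nat_scope.
Implicit Types (m d c : supermon) (I J K : {fset nat}) (s : nat -> nat).

Definition mon1 : supermon := (mset0, fset0).

Definition mdeg m : nat := size m.1 + #|` m.2|.

Definition mdvd d m : bool := (d.1 `<=` m.1)%mset && (d.2 `<=` m.2)%fset.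

Definition mquo m d : supermon := ((m.1 `\` d.1)%mset, (m.2 `\` d.2)%fset).

Definition submsets (a : {mset nat}) : {fset {mset nat}} :=
  [fset seq_mset (mask (tval b) a) | b in {: (size a).-tuple bool}]%fset.

Definition mdivs m : {fset supermon} :=
  [fset ((b, J) : supermon) | b in submsets m.1, J in fpowerset m.2]%fset.

(* theta_J theta_K = (-1)^(crossings J K) theta_(J u K) for disjoint J, K. *)
Definition crossings J K : nat := \sum_(j <- J) \sum_(k <- K) (k < j).

Definition mmap s m : supermon :=
  (seq_mset [seq s i | i <- m.1], [fset s i | i in m.2]%fset).

(* theta_(s i1) ... theta_(s ik) = (-1)^(inversions s I) theta_(s(I)) for
   I = {i1 < ... < ik} and s injective. *)
Definition inversions s I : nat :=
  \sum_(i <- I) \sum_(j <- I) ((i < j) && (s j < s i)).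

Lemma mem_submsets (a b : {mset nat}) : (b \in submsets a) = (b `<=` a)%mset.
Proof.
apply/imfsetP/msubsetP => [[t _ ->] x|ba] /=.
  rewrite mset_seqE -(count_mem_mset x a).
  exact/leq_count_subseq/mask_subseq.
have /count_maskP [t st bt] : forall x, count_mem x b <= count_mem x a.
  by move=> x; rewrite !count_mem_mset.
have st' : size t == size a by rewrite st.
exists (Tuple st') => //=.
by rewrite -(seq_mset_id b); apply/eq_seq_msetP.
Qed.

Lemma mem_mdivs m d : (d \in mdivs m) = mdvd d m.
Proof.
apply/imfset2P/andP => [[b /= hb [J /= hJ ->]]|[h1 h2]].
  by move: hb hJ; rewrite mem_submsets fpowersetE.
exists d.1; first by rewrite /= mem_submsets.
by exists d.2; rewrite /= ?fpowersetE //; case: (d).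
Qed.

Lemma mdvdP d m :
  reflect ((forall i, d.1 i <= m.1 i) /\ {subset d.2 <= m.2}) (mdvd d m).
Proof.
apply: (iffP andP) => -[h1 h2]; first by split; [exact/msubsetP|exact/fsubsetP].
by split; [apply/msubsetP|apply/fsubsetP].
Qed.

Lemma monP c d : (forall i, c.1 i = d.1 i) -> c.2 =i d.2 -> c = d.
Proof.
by case: c d => [a I] [b J] /= h1 h2; congr pair; [apply/msetP|apply/fsetP].
Qed.

Lemma mdvd_refl m : mdvd m m. Proof. by apply/mdvdP; split. Qed.

Lemma mdvd_trans c d m : mdvd c d -> mdvd d m -> mdvd c m.
Proof.
move=> /mdvdP[h1 h2] /mdvdP[h3 h4]; apply/mdvdP; split=> i.
  exact: leq_trans (h1 i) (h3 i).
by move=> /h2/h4.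
Qed.

Lemma mdvd1 m : mdvd mon1 m.
Proof. by apply/mdvdP; split=> i /=; rewrite ?mset0E ?inE. Qed.

Lemma mquo1 m : mquo m mon1 = m.
Proof. by apply: monP => i /=; rewrite ?msetE2 ?mset0E ?subn0 ?inE. Qed.

Lemma mquoxx m : mquo m m = mon1.
Proof.
apply: monP => i /=; first by rewrite msetE2 mset0E subnn.
by rewrite !inE; case: (i \in m.2).
Qed.

Lemma mdvd_quo m d : mdvd (mquo m d) m.
Proof.
apply/mdvdP; split=> i /=; first by rewrite msetE2 leq_subr.
by rewrite !inE => /andP[].
Qed.

Lemma mquoK m d : mdvd d m -> mquo m (mquo m d) = d.
Proof.
move=> /mdvdP[h1 h2]; apply: monP => i /=; first by rewrite !msetE2 subKn.
by rewrite !inE; have := h2 i; case: (i \in d.2) => [->|_] //; case: (_ \in _).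
Qed.

Lemma mquo_eq1 m d : mdvd d m -> (mquo m d == mon1) = (d == m).
Proof.
move=> dm; apply/eqP/eqP => [h|->]; last exact: mquoxx.
by rewrite -(mquoK dm) h mquo1.
Qed.

Lemma mdvd_quo2 c d m : mdvd c d -> mdvd d m -> mdvd (mquo d c) (mquo m c).
Proof.
move=> /mdvdP[h1 h2] /mdvdP[h3 h4]; apply/mdvdP; split=> i /=.
  by rewrite !msetE2 leq_sub2r.
by rewrite !inE => /andP[-> /h4 ->].
Qed.

Lemma mquo_quo c d m : mdvd c d -> mdvd d m ->
  mquo (mquo m c) (mquo d c) = mquo m d.
Proof.
move=> /mdvdP[h1 h2] /mdvdP[h3 h4]; apply: monP => i /=.
  by rewrite !msetE2 subnBA ?h1 // subnK // (leq_trans (h1 i)).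
rewrite !inE; have := h2 i; have := h4 i.
by case: (i \in c.2) => /=; case: (i \in d.2); case: (i \in m.2) => //= _ /(_ _)->.
Qed.

Definition mmul c d : supermon := ((c.1 `+` d.1)%mset, (c.2 `|` d.2)%fset).

Lemma mmul_dvd c m e : mdvd c m -> mdvd e (mquo m c) ->
  [/\ mdvd c (mmul c e), mdvd (mmul c e) m & mquo (mmul c e) c = e].
Proof.
move=> /mdvdP[h1 h2] /mdvdP[h3 h4]; split.
- apply/mdvdP; split=> i /=; first by rewrite msetE2 leq_addr.
  by rewrite !inE => ->.
- apply/mdvdP; split=> i /=.
    by rewrite msetE2 -leq_subRL //; have := h3 i; rewrite /= msetE2.
  by rewrite !inE => /orP[/h2//|/h4]; rewrite !inE => /andP[].
- apply: monP => i /=; first by rewrite !msetE2 addKn.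
  rewrite !inE; have := h4 i; rewrite !inE.
  by case: (i \in c.2) => //=; case: (i \in e.2) => //= /(_ isT).
Qed.

Lemma mmul_quo c d : mdvd c d -> mmul c (mquo d c) = d.
Proof.
move=> /mdvdP[h1 h2]; apply: monP => i /=; first by rewrite !msetE2 subnKC.
by rewrite !inE; have := h2 i; case: (i \in c.2) => // ->.
Qed.

Lemma perm_mdivs_quo m c : mdvd c m ->
  perm_eq [seq d <- mdivs m | mdvd c d] [seq mmul c e | e <- mdivs (mquo m c)].
Proof.
move=> cm; apply: uniq_perm; first by rewrite filter_uniq ?fset_uniq.
  rewrite map_inj_in_uniq ?fset_uniq // => e e'; rewrite !mem_mdivs => he he' E.
  by have [_ _ <-] := mmul_dvd cm he; have [_ _ <-] := mmul_dvd cm he'; rewrite E.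
move=> d; rewrite mem_filter mem_mdivs; apply/andP/mapP => [[cd dm]|[e he ->]].
  by exists (mquo d c); rewrite ?mmul_quo // mem_mdivs mdvd_quo2.
by move: he; rewrite mem_mdivs => /(mmul_dvd cm)[].
Qed.

Lemma perm_mdivs_compl m : perm_eq (mdivs m) [seq mquo m d | d <- mdivs m].
Proof.
apply: uniq_perm; first exact: fset_uniq.
  rewrite map_inj_in_uniq ?fset_uniq // => e e'; rewrite !mem_mdivs => he he' E.
  by rewrite -(mquoK he) E mquoK.
move=> d; rewrite mem_mdivs; apply/idP/mapP => [dm|[e he ->]].
  by exists (mquo m d); rewrite ?mquoK // mem_mdivs mdvd_quo.
exact: mdvd_quo.
Qed.

Lemma perm_fsetD I J : (J `<=` I)%fset -> perm_eq I (J ++ (I `\` J)%fset).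
Proof.
move=> JI; apply: uniq_perm; first exact: fset_uniq.
  rewrite cat_uniq !fset_uniq /= andbT; apply/hasPn => x.
  by rewrite inE => /andP[].
move=> x; rewrite mem_cat inE; have := fsubsetP JI x.
by case: (x \in J) => //= ->.
Qed.

Lemma crossingsDl I J K : (J `<=` I)%fset ->
  crossings I K = crossings J K + crossings (I `\` J)%fset K.
Proof. by move=> JI; rewrite /crossings (perm_big _ (perm_fsetD JI)) big_cat. Qed.

Lemma crossingsDr I J K : (J `<=` I)%fset ->
  crossings K I = crossings K J + crossings K (I `\` J)%fset.
Proof.
move=> JI; rewrite /crossings -big_split /=; apply: eq_bigr => j _.
by rewrite (perm_big _ (perm_fsetD JI)) big_cat.
Qed.

Lemma crossings0l K : crossings fset0 K = 0.
Proof. by rewrite /crossings big_seq_fset0. Qed.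

Lemma crossings0r K : crossings K fset0 = 0.
Proof. by rewrite /crossings big1 // => j _; rewrite big_seq_fset0. Qed.

Lemma crossings_assoc c d m : mdvd c d -> mdvd d m ->
  crossings c.2 (d.2 `\` c.2)%fset + crossings d.2 (m.2 `\` d.2)%fset =
  crossings c.2 (m.2 `\` c.2)%fset +
  crossings (d.2 `\` c.2)%fset (m.2 `\` d.2)%fset.
Proof.
move=> cd dm; have [_ cd2] := andP cd; have [_ dm2] := andP dm.
rewrite (crossingsDl _ cd2) (@crossingsDr (m.2 `\` c.2)%fset (d.2 `\` c.2)%fset); last first.
  exact: fsetSD.
have -> : ((m.2 `\` c.2) `\` (d.2 `\` c.2) = m.2 `\` d.2)%fset.
  by have [] := mquo_quo cd dm.
by rewrite addnA.
Qed.

Lemma crossingsC J K : (forall x, x \in J -> x \notin K) ->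
  crossings J K + crossings K J = #|` J| * #|` K|.
Proof.
move=> dis; rewrite /crossings [X in _ + X]exchange_big -big_split /=.
rewrite (eq_big_seq (fun=> #|` K|)) => [|j jJ].
  by rewrite big_const_seq count_predT iter_addn_0 mulnC.
rewrite -big_split /= (eq_big_seq (fun=> 1)) => [|k kK]; first by rewrite sum1_size.
have : j != k by apply: contraL kK => /eqP <-; exact: dis.
by case: ltngtP.
Qed.

Lemma mdeg_quo d m : mdvd d m -> mdeg m = mdeg d + mdeg (mquo m d).
Proof.
move=> /andP[h1 h2]; rewrite /mdeg /= addnACA; congr addn; last first.
  by rewrite (perm_size (perm_fsetD h2)) size_cat.
rewrite -size_cat; apply: perm_size; rewrite /perm_eq.
apply/allP => x _ /=; rewrite count_cat !count_mem_mset msetE2 subnKC //.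
by have /msubsetP := h1.
Qed.

Lemma odd_card_quo d m : mdvd d m ->
  odd #|` m.2| = odd #|` d.2| (+) odd #|` (mquo m d).2|.
Proof.
by move=> /andP[_ h2]; rewrite (perm_size (perm_fsetD h2)) size_cat oddD.
Qed.

Lemma mdeg_eq0 m : (mdeg m == 0) = (m == mon1).
Proof.
case: m => a I; rewrite /mdeg addn_eq0 size_mset_eq0 cardfs_eq0 /=.
by apply/andP/eqP => [[/eqP -> /eqP ->]|[-> ->]].
Qed.

Section Permutation.
Variables s g : nat -> nat.
Hypotheses (sK : cancel s g) (gK : cancel g s).

Lemma mmap1E m i : (mmap s m).1 i = m.1 (g i).
Proof.
rewrite mset_seqE count_map -count_mem_mset; apply: eq_count => j /=.
by rewrite (can2_eq sK gK).
Qed.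

Lemma mmap2E m i : (i \in (mmap s m).2) = (g i \in m.2).
Proof.
apply/imfsetP/idP => [[j jm ->]|h]; first by rewrite sK.
by exists (g i); rewrite ?gK.
Qed.

Lemma mmapK : cancel (mmap s) (mmap g).
Proof.
move=> m; case: m => a I; congr pair => /=.
  have /eq_seq_msetP -> : perm_eq [seq g i | i <- seq_mset [seq s i | i <- a]]
      [seq g i | i <- [seq s i | i <- a]] by apply/perm_map/perm_eq_seq_mset.
  by rewrite mapK // seq_mset_id.
apply/fsetP => i; apply/imfsetP/idP => [[j /imfsetP[k kI ->] ->]|iI].
  by rewrite sK.
by exists (s i); rewrite ?sK //= in_imfset.
Qed.

Lemma mmap_quo m d : mquo (mmap s m) (mmap s d) = mmap s (mquo m d).
Proof.
apply: monP => i.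
  by rewrite [LHS]msetE2 !mmap1E [RHS]msetE2.
by rewrite [LHS]in_fsetD !mmap2E [RHS]in_fsetD.
Qed.

Lemma mmap_dvd m d : mdvd (mmap s d) (mmap s m) = mdvd d m.
Proof.
apply/mdvdP/mdvdP => -[h1 h2]; split=> i.
- by have := h1 (s i); rewrite !mmap1E sK.
- by have := h2 (s i); rewrite !mmap2E sK.
- by rewrite !mmap1E.
- by rewrite !mmap2E; apply: h2.
Qed.

Lemma mmap_mon1 : mmap s mon1 = mon1.
Proof. by apply: monP => i; rewrite ?mmap1E ?mmap2E /= ?mset0E ?inE. Qed.

Lemma crossings_perm I J : (J `<=` I)%fset -> let K := (I `\` J)%fset in
  odd (crossings [fset s i | i in J]%fset [fset s i | i in K]%fset
       + (inversions s J + inversions s K))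
  = odd (inversions s I + crossings J K).
Proof.
move=> JI K.
have -> : crossings [fset s i | i in J]%fset [fset s i | i in K]%fset
    = \sum_(j <- J) \sum_(k <- K) (s k < s j).
  rewrite /crossings big_imfset /=; last by move=> x y _ _ /(can_inj sK).
  apply: eq_bigr => j _.
  by rewrite big_imfset //= => x y _ _ /(can_inj sK).
have -> : inversions s I = inversions s J + inversions s K +
    \sum_(j <- J) \sum_(k <- K) (((j < k) && (s k < s j)) + ((k < j) && (s j < s k))).
  rewrite /inversions (perm_big _ (perm_fsetD JI)) big_cat /=.
  under eq_bigr do rewrite (perm_big _ (perm_fsetD JI)) big_cat /=.
  under [X in _ + X = _]eq_bigr do rewrite (perm_big _ (perm_fsetD JI)) big_cat /=.
  under [X in _ = _ + X]eq_bigr do rewrite big_split /=.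
  rewrite !big_split /= [X in _ + (X + _)]exchange_big /=.
  by rewrite [X in _ + X = _]addnC addnACA.
rewrite addnC -[in RHS]addnA 2!(oddD (inversions _ _ + _)); congr (_ (+) _).
rewrite /crossings -big_split /=.
under [in RHS]eq_bigr do rewrite -big_split /=.
have odd_sum (A : seq nat) (F G : nat -> nat) :
    (forall x, x \in A -> odd (F x) = odd (G x)) ->
    odd (\sum_(x <- A) F x) = odd (\sum_(x <- A) G x).
  elim: A => [|x A IH] h; first by rewrite !big_nil.
  rewrite !big_cons !oddD h ?mem_head // IH // => y yA.
  by apply: h; rewrite inE yA orbT.
apply: (odd_sum) => j jJ; apply: odd_sum => k; rewrite inE => /andP[kJ _].
have jk : j != k by apply: contraNneq kJ => <-.
have : s j != s k by rewrite (can_eq sK).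
by case: (ltngtP j k) jk => // _ _; case: (ltngtP (s j) (s k)).
Qed.

End Permutation.

Lemma perm_mdivs_mmap s g m : cancel s g -> cancel g s ->
  perm_eq (mdivs (mmap s m)) [seq mmap s d | d <- mdivs m].
Proof.
move=> sK gK; apply: uniq_perm; first exact: fset_uniq.
  by rewrite (map_inj_uniq (can_inj (mmapK sK))) fset_uniq.
move=> d; apply/idP/mapP => [|[e he ->]].
  rewrite mem_mdivs -{1}[d](mmapK gK) (mmap_dvd sK gK) -mem_mdivs => h.
  by exists (mmap g d); rewrite ?(mmapK gK).
by rewrite mem_mdivs (mmap_dvd sK gK) -mem_mdivs.
Qed.

End Monomials.

Local Open Scope ring_scope.

(* Formal series in the x_i and theta_i, i >= 0, with integer coefficients. *)
Record superseries := SuperSeries { coef : supermon -> int }.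

HB.instance Definition _ := gen_eqMixin superseries.
HB.instance Definition _ := gen_choiceMixin superseries.

Lemma superseriesP (f g : superseries) : (forall m, coef f m = coef g m) -> f = g.
Proof. by case: f g => [f] [g] /= h; congr SuperSeries; apply/funext. Qed.

Definition sszero := SuperSeries (fun=> 0).
Definition ssopp f := SuperSeries (fun m => - coef f m).
Definition ssadd f g := SuperSeries (fun m => coef f m + coef g m).

Lemma ssaddA : associative ssadd.
Proof. by move=> f g h; apply: superseriesP => m /=; rewrite addrA. Qed.
Lemma ssaddC : commutative ssadd.
Proof. by move=> f g; apply: superseriesP => m /=; rewrite addrC. Qed.
Lemma ssadd0 : left_id sszero ssadd.
Proof. by move=> f; apply: superseriesP => m /=; rewrite add0r. Qed.
Lemma ssaddN : left_inverse sszero ssopp ssadd.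
Proof. by move=> f; apply: superseriesP => m /=; rewrite addNr. Qed.

HB.instance Definition _ :=
  GRing.isZmodule.Build superseries ssaddA ssaddC ssadd0 ssaddN.

Definition ssone := SuperSeries (fun m => (m == mon1)%:R).

Definition ssmul f g := SuperSeries (fun m => \sum_(d <- mdivs m)
  (-1) ^+ crossings d.2 (mquo m d).2 * (coef f d * coef g (mquo m d))).

Lemma ssmulA : associative ssmul.
Proof.
move=> f g h; apply: superseriesP => m /=.
under eq_bigr do rewrite mulrA mulr_sumr.
under [in RHS]eq_bigr do rewrite mulr_suml mulr_sumr.
pose T (d c : supermon) : int :=
  (-1) ^+ crossings d.2 (mquo m d).2 * ((-1) ^+ crossings c.2 (mquo d c).2
   * (coef f c * coef g (mquo d c)) * coef h (mquo m d)).
have -> : \sum_(d <- mdivs m) \sum_(c <- mdivs d)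
    (-1) ^+ crossings d.2 (mquo m d).2 * ((-1) ^+ crossings c.2 (mquo d c).2
     * (coef f c * coef g (mquo d c)) * coef h (mquo m d)) =
    \sum_(d <- mdivs m) \sum_(c <- mdivs m | mdvd c d) T d c.
  apply: eq_big_seq => d; rewrite mem_mdivs => dm.
  rewrite -[RHS]big_filter; apply: perm_big; apply: uniq_perm.
  - exact: fset_uniq.
  - by rewrite filter_uniq ?fset_uniq.
  move=> c; rewrite mem_filter !mem_mdivs; apply/idP/andP => [cd|[]//].
  by split=> //; exact: mdvd_trans dm.
rewrite (exchange_big_dep predT) //=; apply: eq_big_seq => c.
rewrite mem_mdivs => cm; rewrite -[RHS]big_filter.
rewrite (perm_big _ (perm_mdivs_quo cm)) big_map; apply: eq_big_seq => e.
rewrite mem_mdivs => /(mmul_dvd cm) [cd dm E].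
rewrite /T; move: (mmul c e) E cd dm => d <- cd dm; rewrite (mquo_quo cd dm).
have : (-1) ^+ crossings c.2 (mquo d c).2 * (-1) ^+ crossings d.2 (mquo m d).2
     = (-1) ^+ crossings c.2 (mquo m c).2
       * (-1) ^+ crossings (mquo d c).2 (mquo m d).2 :> int.
  by rewrite -!exprD (crossings_assoc cd dm).
move: (coef f c) (coef g _) (coef h _) => x y z.
set p := (X in X * _ = _); set q := (X in _ * X = _) => S.
rewrite (congr1 snd (mquo_quo cd dm) : (_ `\` _)%fset = _).
by transitivity (p * q * (x * y * z)); [rewrite S|rewrite /p /q]; ring.
Qed.

Lemma ssmul1 : left_id ssone ssmul.
Proof.
move=> f; apply: superseriesP => m /=.
rewrite (big_fsetD1 mon1) /= ?mem_mdivs ?mdvd1 //.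
rewrite [X in _ + X]big_seq big1 ?addr0; last first.
  by move=> d; rewrite in_fsetD1 => /andP[/negPf -> _]; rewrite mul0r mulr0.
by rewrite crossings0l eqxx !mul1r mquo1.
Qed.

Lemma ssmulr1 : right_id ssone ssmul.
Proof.
move=> f; apply: superseriesP => m /=.
rewrite (big_fsetD1 m) /= ?mem_mdivs ?mdvd_refl //.
rewrite [X in _ + X]big_seq big1 ?addr0; last first.
  move=> d; rewrite in_fsetD1 mem_mdivs => /andP[dm dvm].
  by rewrite mquo_eq1 // (negPf dm) !mulr0.
have := mquoxx m; rewrite /mquo => -[-> ->].
by rewrite crossings0r eqxx mulr1 mul1r.
Qed.

Lemma ssmulDl : left_distributive ssmul ssadd.
Proof.
move=> f g h; apply: superseriesP => m /=; rewrite -big_split /=.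
by apply: eq_bigr => d _; rewrite mulrDl mulrDr.
Qed.

Lemma ssmulDr : right_distributive ssmul ssadd.
Proof.
move=> f g h; apply: superseriesP => m /=; rewrite -big_split /=.
by apply: eq_bigr => d _; rewrite !mulrDr.
Qed.

Lemma ssone_neq0 : ssone != 0.
Proof. by apply/eqP => /(congr1 (fun f => coef f mon1)) /=; rewrite eqxx. Qed.

HB.instance Definition _ := GRing.Zmodule_isNzRing.Build superseries
  ssmulA ssmul1 ssmulr1 ssmulDl ssmulDr ssone_neq0.

Definition ssunit : {pred superseries} :=
  fun f => `[< exists g : superseries, g * f = 1 /\ f * g = 1 >].

Definition ssinv (f : superseries) : superseries :=
  if pselect (exists g : superseries, g * f = 1 /\ f * g = 1) is left ex
  then projT1 (cid ex) else f.

Lemma ssmulVr : {in ssunit, left_inverse 1 ssinv *%R}.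
Proof.
move=> f /asboolP uf; rewrite /ssinv; case: pselect => // ex.
by case: cid => g [].
Qed.

Lemma ssdivrr : {in ssunit, right_inverse 1 ssinv *%R}.
Proof.
move=> f /asboolP uf; rewrite /ssinv; case: pselect => // ex.
by case: cid => g [].
Qed.

Lemma ssunitP (f g : superseries) : g * f = 1 /\ f * g = 1 -> f \in ssunit.
Proof. by move=> h; apply/asboolP; exists g. Qed.

Lemma ssinv_out : {in [predC ssunit], ssinv =1 id}.
Proof.
move=> f uf; rewrite /ssinv; case: pselect => // ex.
by case/negP: uf; apply/asboolP.
Qed.

HB.instance Definition _ := GRing.NzRing_hasMulInverse.Build superseries
  ssmulVr ssdivrr ssunitP ssinv_out.

Definition ssX (i : nat) := SuperSeries (fun m => (m == ([mset i], fset0))%:R).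
Definition ssTheta (i : nat) :=
  SuperSeries (fun m => (m == (mset0, [fset i]%fset))%:R).

(* ss_act s f g: the substitution x_i := x_(s i), theta_i := theta_(s i) maps
   f to g. *)
Definition ss_act (s : nat -> nat) (f g : superseries) : Prop :=
  forall m, coef g (mmap s m) = (-1) ^+ inversions s m.2 * coef f m.

Definition finite_perm (s : nat -> nat) : Prop :=
  bijective s /\ exists N, forall i, (N <= i)%N -> s i = i.

Definition ss_symmetric (f : superseries) : Prop :=
  forall s, finite_perm s -> ss_act s f f.

Definition bounded_degree (f : superseries) : Prop :=
  exists N, forall m, (N < mdeg m)%N -> coef f m = 0.

(* The ring of symmetric series of bounded degree, called symsuper below. *)
Definition symsuper_pred : {pred superseries} :=
  fun f => `[< bounded_degree f /\ ss_symmetric f >].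

Lemma sscoef1 m : coef 1 m = (m == mon1)%:R. Proof. by []. Qed.
Lemma sscoef0 m : coef 0 m = 0. Proof. by []. Qed.
Lemma sscoefD f g m : coef (f + g) m = coef f m + coef g m. Proof. by []. Qed.
Lemma sscoefN f m : coef (- f) m = - coef f m. Proof. by []. Qed.
Lemma sscoefM f g m : coef (f * g) m = \sum_(d <- mdivs m)
  (-1) ^+ crossings d.2 (mquo m d).2 * (coef f d * coef g (mquo m d)).
Proof. by []. Qed.
Lemma sscoef_sum I (r : seq I) (F : I -> superseries) m :
  coef (\sum_(i <- r) F i) m = \sum_(i <- r) coef (F i) m.
Proof.
by elim: r => [|i r IH]; rewrite ?big_nil // !big_cons sscoefD IH.
Qed.

Lemma ss_act1 s g : cancel s g -> cancel g s -> ss_act s 1 1.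
Proof.
move=> sK gK m; rewrite !sscoef1 -(inj_eq (can_inj (mmapK sK)) m).
rewrite (mmap_mon1 sK gK) (can2_eq (mmapK sK) (mmapK gK)).
rewrite (mmap_mon1 gK sK).
case: eqP => [->|_]; last by rewrite mulr0.
by rewrite /inversions big_seq_fset0 mulr1.
Qed.

Lemma ss_actD s f1 g1 f2 g2 :
  ss_act s f1 g1 -> ss_act s f2 g2 -> ss_act s (f1 + f2) (g1 + g2).
Proof. by move=> h1 h2 m; rewrite !sscoefD h1 h2 mulrDr. Qed.

Lemma ss_actN s f g : ss_act s f g -> ss_act s (- f) (- g).
Proof. by move=> h m; rewrite !sscoefN h mulrN. Qed.

Lemma ss_actM s t f1 g1 f2 g2 : cancel s t -> cancel t s ->
  ss_act s f1 g1 -> ss_act s f2 g2 -> ss_act s (f1 * f2) (g1 * g2).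
Proof.
move=> sK tK h1 h2 m; rewrite !sscoefM (perm_big _ (perm_mdivs_mmap m sK tK)).
rewrite big_map mulr_sumr; apply: eq_big_seq => d; rewrite mem_mdivs => dm.
rewrite (mmap_quo sK tK) h1 h2.
have [_ dm2] := andP dm; have := crossings_perm sK dm2.
move=> /= /(congr1 (fun b : bool => (-1) ^+ b : int)).
rewrite !signr_odd !exprD /= => E.
transitivity ((-1) ^+ crossings (mmap s d).2 (mmap s (mquo m d)).2
  * ((-1) ^+ inversions s d.2 * (-1) ^+ inversions s (mquo m d).2)
  * (coef f1 d * coef f2 (mquo m d))); first by ring.
by rewrite E; ring.
Qed.

Lemma symsuper_subring : subring_closed symsuper_pred.
Proof.
split.
- apply/asboolP; split; last by move=> s [[g sK gK] _]; exact: ss_act1 sK gK.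
  by exists 0%N => m; rewrite sscoef1 lt0n mdeg_eq0 => /negPf ->.
- move=> f g /asboolP[[N hN] hf] /asboolP[[M hM] hg]; apply/asboolP; split.
    exists (maxn N M) => m; rewrite gtn_max => /andP[h1 h2].
    by rewrite sscoefD sscoefN hN // hM // subrr.
  by move=> s hs; apply: ss_actD; [|apply: ss_actN]; auto.
move=> f g /asboolP[[N hN] hf] /asboolP[[M hM] hg]; apply/asboolP; split.
  exists (N + M)%N => m hm; rewrite sscoefM big_seq big1 // => d.
  rewrite mem_mdivs => dm; move: hm; rewrite (mdeg_quo dm) => hm.
  have [h|h] := leqP (mdeg d) N; last by rewrite hN ?mul0r ?mulr0.
  rewrite (hM (mquo m d)) ?mulr0 //.
  by rewrite -(ltn_add2l N) (leq_trans hm) // leq_add2r.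
by move=> s hs; have [[t sK tK] _] := hs; apply: (ss_actM sK tK); auto.
Qed.

HB.instance Definition _ :=
  GRing.isSubringClosed.Build superseries symsuper_pred symsuper_subring.

Record symsuper := SymSuper
  { symsuper_val : superseries; _ : symsuper_val \in symsuper_pred }.

HB.instance Definition _ := [isSub for symsuper_val].
HB.instance Definition _ := [Choice of symsuper by <:].
HB.instance Definition _ := [SubChoice_isSubNzRing of symsuper by <:].

(* The eventual value of a sequence of integers, 0 if there is none. *)
Definition stable_value (u : nat -> int) : int :=
  if pselect (exists c, exists N, forall n, (N <= n)%N -> u n = c) is left ex
  then projT1 (cid ex) else 0.

(* Infinite product, for the topology of coefficientwise stabilization. *)
Definition infprod (F : nat -> superseries) := SuperSeries (fun m =>
  stable_value (fun n => coef (\prod_(i < n) F i) m)).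

(* In the generating series the parameters t and tau are the variables of index
   0, while x_i and theta_i have index i + 1. *)
Definition gen_t := ssX 0.
Definition gen_tau := ssTheta 0.
Definition gen_x i := ssX i.+1.
Definition gen_theta i := ssTheta i.+1.

Definition gen_e : superseries :=
  infprod (fun i => 1 + gen_t * gen_x i + gen_tau * gen_theta i).

Definition gen_h : superseries :=
  infprod (fun i => (1 - gen_t * gen_x i - gen_tau * gen_theta i)^-1).

(* The monomials t^n m and t^n tau m, for m a monomial in the x_i and theta_i.
   tau stands to the left of the theta_i because its index is the smallest, so
   no sign arises. *)
Definition tmon (n : nat) (m : supermon) : supermon :=
  ((msetn n 0 `+` (mmap S m).1)%mset, (mmap S m).2).
Definition ttaumon (n : nat) (m : supermon) : supermon :=
  ((msetn n 0 `+` (mmap S m).1)%mset, (0 |` (mmap S m).2)%fset).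

(* A_n and B_n when G is written as the sum of the t^n (A_n + tau B_n). *)
Definition coef_t (G : superseries) (n : nat) : superseries :=
  SuperSeries (fun m => coef G (tmon n m)).
Definition coef_ttau (G : superseries) (n : nat) : superseries :=
  SuperSeries (fun m => coef G (ttaumon n m)).

Definition supp_in (S : pred supermon) (f : superseries) : Prop :=
  forall m, ~~ S m -> coef f m = 0.

Lemma supp_inM (S1 S2 S : pred supermon) f g :
  (forall d m, mdvd d m -> S1 d -> S2 (mquo m d) -> S m) ->
  supp_in S1 f -> supp_in S2 g -> supp_in S (f * g).
Proof.
move=> H h1 h2 m Sm; rewrite sscoefM big_seq big1 // => d; rewrite mem_mdivs => dm.
case: (boolP (S1 d)) => [s1|/h1->]; last by rewrite mul0r mulr0.
case: (boolP (S2 (mquo m d))) => [s2|/h2->]; last by rewrite !mulr0.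
by case/negP: Sm; apply: H dm s1 s2.
Qed.

Lemma supp_inD S f g : supp_in S f -> supp_in S g -> supp_in S (f + g).
Proof. by move=> h1 h2 m Sm; rewrite sscoefD h1 // h2 // addr0. Qed.

Lemma supp_inN S f : supp_in S f -> supp_in S (- f).
Proof. by move=> h1 m Sm; rewrite sscoefN h1 // oppr0. Qed.

Lemma supp_in1 (S : pred supermon) : S mon1 -> supp_in S 1.
Proof. by move=> h m Sm; rewrite sscoef1; case: eqP Sm => // ->; rewrite h. Qed.

Definition mclosed (S : pred supermon) : Prop :=
  S mon1 /\ forall d m, mdvd d m -> S d -> S (mquo m d) -> S m.

Lemma supp_inX S f k : mclosed S -> supp_in S f -> supp_in S (f ^+ k).
Proof.
move=> [S1 SM] hf; elim: k => [|k IH]; first by rewrite expr0; exact: supp_in1.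
by rewrite exprS; apply: supp_inM hf IH.
Qed.

Lemma supp_deg u k : coef u mon1 = 0 -> supp_in (fun m => (k <= mdeg m)%N) (u ^+ k).
Proof.
move=> u0; elim: k => [m //|k IH]; rewrite exprS.
apply: (@supp_inM (fun m => 0 < mdeg m)%N _ _ _ _ _ _ IH) => [d m dm h1 h2|m].
  by rewrite (mdeg_quo dm) -add1n leq_add.
by rewrite -eqn0Ngt mdeg_eq0 => /eqP ->.
Qed.

Definition geom u := SuperSeries (fun m => \sum_(k < (mdeg m).+1) coef (u ^+ k) m).

Lemma geom_coef u m N : coef u mon1 = 0 -> (mdeg m < N)%N ->
  coef (geom u) m = coef (\sum_(k < N) u ^+ k) m.
Proof.
move=> u0 mN; rewrite sscoef_sum /= (big_ord_widen N (fun k => coef (u ^+ k) m)) //.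
rewrite big_mkcond /=; apply: eq_bigr => k _; case: ltnP => // h.
by rewrite supp_deg // -ltnNge.
Qed.

Lemma eq_coefM f f' g g' m :
  (forall d, mdvd d m -> coef f d = coef f' d) ->
  (forall d, mdvd d m -> coef g d = coef g' d) ->
  coef (f * g) m = coef (f' * g') m.
Proof.
move=> h1 h2; rewrite !sscoefM; apply: eq_big_seq => d; rewrite mem_mdivs => dm.
by rewrite h1 // h2 // mdvd_quo.
Qed.

Lemma mdvd_deg d m : mdvd d m -> (mdeg d <= mdeg m)%N.
Proof. by move=> dm; rewrite (mdeg_quo dm) leq_addr. Qed.

Lemma geomP u : coef u mon1 = 0 -> geom u * (1 - u) = 1 /\ (1 - u) * geom u = 1.
Proof.
move=> u0; have E m : (1 - u) * \sum_(k < (mdeg m).+1) u ^+ k = 1 - u ^+ (mdeg m).+1.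
  by rewrite -opprB mulNr -subrX1 opprB.
have C m : (1 - u) * \sum_(k < (mdeg m).+1) u ^+ k
         = (\sum_(k < (mdeg m).+1) u ^+ k) * (1 - u).
  rewrite mulr_sumr mulr_suml; apply: eq_bigr => k _.
  by rewrite mulrBl mulrBr mul1r mulr1 -exprS -exprSr.
have Z m : coef (u ^+ (mdeg m).+1) m = 0 by rewrite supp_deg // -ltnNge.
have G d m : mdvd d m -> coef (geom u) d = coef (\sum_(k < (mdeg m).+1) u ^+ k) d.
  by move=> /mdvd_deg dm; apply: geom_coef.
split; apply: superseriesP => m.
  rewrite (@eq_coefM _ (\sum_(k < (mdeg m).+1) u ^+ k) _ (1 - u)) // => [|d /G] //.
  by rewrite -C E sscoefD sscoefN Z subr0.
rewrite (@eq_coefM _ (1 - u) _ (\sum_(k < (mdeg m).+1) u ^+ k)) // => [|d /G] //.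
by rewrite E sscoefD sscoefN Z subr0.
Qed.

Lemma unit_geom u : coef u mon1 = 0 -> 1 - u \is a GRing.unit.
Proof. by move=> /geomP h; apply/ssunitP; apply: h. Qed.

Lemma inv_geom u : coef u mon1 = 0 -> (1 - u)^-1 = geom u.
Proof.
move=> u0; have [_ h] := geomP u0.
by apply: (mulrI (unit_geom u0)); rewrite h divrr // unit_geom.
Qed.

Lemma supp_in_inv S u : coef u mon1 = 0 -> mclosed S -> supp_in S u ->
  supp_in S (1 - u)^-1.
Proof.
move=> u0 hS hu m Sm; rewrite inv_geom //= big1 // => k _.
exact: (supp_inX _ hS hu).
Qed.

Lemma sscoefM1 f g : coef (f * g) mon1 = coef f mon1 * coef g mon1.
Proof.
have E : mdivs mon1 = [fset mon1]%fset.
  apply/fsetP => d; rewrite mem_mdivs inE; apply/idP/eqP => [dm|->].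
    apply/eqP; rewrite -mquo_eq1 //; apply/eqP/monP => i /=.
      by rewrite msetE2 mset0E sub0n.
    by rewrite !inE andbF.
  exact: mdvd_refl.
by rewrite sscoefM E big_seq_fset1 /= mquo1 crossings0l mul1r.
Qed.

Lemma coef1_inv u : coef u mon1 = 0 -> coef (1 - u)^-1 mon1 = 1.
Proof.
move=> u0; have := congr1 (coef^~ mon1) (divrr (unit_geom u0)).
by rewrite sscoefM1 sscoefD sscoefN u0 !sscoef1 eqxx subr0 mul1r.
Qed.

Definition involves i (m : supermon) := (i \in m.1) || (i \in m.2).
Definition nearly i (m : supermon) := (m == mon1) || involves i m.

Lemma involves_quo i d m : mdvd d m ->
  involves i m = involves i d || involves i (mquo m d).
Proof.
move=> /mdvdP[h1 h2]; rewrite /involves /= in_msetB !inE !in_mset.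
have := h1 i; have := h2 i.
case: (i \in d.2) => /= [/(_ isT) -> _|_]; first by rewrite !orbT.
case: (i \in m.2); rewrite ?orbT ?orbF // => h; case: (d.1 i) h => //= n h.
by rewrite (leq_ltn_trans _ h).
Qed.

Lemma nearly_closed i : mclosed (nearly i).
Proof.
split=> [|d m dm]; rewrite /nearly ?eqxx //.
rewrite mquo_eq1 // [in X in _ -> _ -> X](involves_quo _ dm).
move=> /orP[/eqP E|->]; last by rewrite orbT.
by move=> /orP[/eqP <-|->]; rewrite ?E ?eqxx ?orbT.
Qed.

Definition good (F : nat -> superseries) : Prop :=
  forall i, supp_in (nearly i.+1) (F i) /\ coef (F i) mon1 = 1.

Lemma good_stable F m N n : good F ->
  (forall i, (N <= i)%N -> ~~ involves i.+1 m) -> (N <= n)%N ->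
  coef (\prod_(i < n) F i) m = coef (\prod_(i < N) F i) m.
Proof.
move=> gF hN; elim: n => [|n IH]; first by rewrite leqn0 => /eqP ->.
rewrite leq_eqVlt => /orP[/eqP -> //|]; rewrite ltnS => Nn.
rewrite -IH // big_ord_recr sscoefM.
rewrite (big_fsetD1 m) /= ?mem_mdivs ?mdvd_refl //.
have [gs g1] := gF n.
rewrite [X in _ + X]big_seq [X in _ + X]big1 ?addr0; last first.
  move=> d; rewrite in_fsetD1 mem_mdivs => /andP[dm dvm].
  rewrite gs ?mulr0 // /nearly mquo_eq1 // (negPf dm) /=.
  by have := hN n Nn; rewrite (involves_quo _ dvm) negb_or => /andP[].
have E := mquoxx m; rewrite E (congr1 snd E : (_ `\` _)%fset = _).
by rewrite crossings0r g1 mulr1 mul1r.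
Qed.

Lemma involves_bound m : exists N, forall i, (N <= i)%N -> ~~ involves i.+1 m.
Proof.
exists (\max_(j <- m.1) j + \max_(j <- m.2) j)%N => i hi; rewrite /involves.
rewrite negb_or; apply/andP; split; apply/negP => h.
  have := @leq_bigmax_seq _ _ xpredT id _ h isT; rewrite leqNgt => /negP; apply.
  by rewrite ltnS (leq_trans _ hi) // leq_addr.
have := @leq_bigmax_seq _ _ xpredT id _ h isT; rewrite leqNgt => /negP; apply.
by rewrite ltnS (leq_trans _ hi) // leq_addl.
Qed.

Lemma infprod_coef F m N : good F ->
  (forall i, (N <= i)%N -> ~~ involves i.+1 m) ->
  coef (infprod F) m = coef (\prod_(i < N) F i) m.
Proof.
move=> gF hN; rewrite /= /stable_value; case: pselect => [ex|[]]; last first.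
  by exists (coef (\prod_(i < N) F i) m), N => n /(good_stable gF hN).
case: cid => c [M hM] /=; rewrite -(hM (maxn M N)) ?leq_maxl //.
exact: good_stable gF hN (leq_maxr _ _).
Qed.

Definition even_mon (m : supermon) := ~~ odd #|` m.2|.

Lemma even_comm f g : supp_in even_mon f -> f * g = g * f.
Proof.
move=> ef; apply: superseriesP => m; rewrite !sscoefM.
rewrite (perm_big _ (perm_mdivs_compl m)) big_map; apply: eq_big_seq => d.
rewrite mem_mdivs => dm; rewrite mquoK //.
case: (boolP (even_mon (mquo m d))) => [ev|/ef ->]; last by rewrite mul0r !mulr0.
rewrite [coef f _ * _]mulrC; congr (_ * _).
rewrite -signr_odd -[RHS]signr_odd; congr (_ ^+ nat_of_bool _); apply/eqP.
rewrite -negb_add -oddD crossingsC => [|x]; first by rewrite oddM (negPf ev).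
by rewrite inE => /andP[].
Qed.

Lemma even_closed : mclosed even_mon.
Proof.
split=> [|d m dm]; rewrite /even_mon ?cardfs0 //.
by rewrite (odd_card_quo dm) => /negPf -> /negPf ->.
Qed.

(* Degree in (t, tau) equal to the degree in (x, theta). *)
Definition bal (m : supermon) := (mdeg m == (m.1 0 + (0 \in m.2)) .*2)%N.

Lemma bal_closed : mclosed bal.
Proof.
split=> [|d m dm]; rewrite /bal; first by rewrite /= mset0E ?inE /mdeg size_mset0 cardfs0.
move=> /eqP h1 /eqP h2; rewrite (mdeg_quo dm) h1 h2 -doubleD; apply/eqP; congr _.*2.
have /mdvdP[dm1 dm2] := dm; rewrite /= msetE2 inE addnACA subnKC //.
by congr addn; have := dm2 0%N; case: (0%N \in d.2) => //= ->.
Qed.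

Lemma supp_ssX (P : pred supermon) i : P ([mset i], fset0) -> supp_in P (ssX i).
Proof. by move=> h m Pm /=; case: eqP Pm => // ->; rewrite h. Qed.

Lemma supp_ssTheta (P : pred supermon) i :
  P (mset0, [fset i]%fset) -> supp_in P (ssTheta i).
Proof. by move=> h m Pm /=; case: eqP Pm => // ->; rewrite h. Qed.

Definition gen_u i := gen_t * gen_x i + gen_tau * gen_theta i.

Lemma coefX_mon1 i : coef (ssX i) mon1 = 0.
Proof. by rewrite /=; case: eqP => // -[] /msetP /(_ i); rewrite mset0E msetnxx. Qed.

Lemma coefTheta_mon1 i : coef (ssTheta i) mon1 = 0.
Proof. by rewrite /=; case: eqP => // -[] /fsetP /(_ i); rewrite !inE eqxx. Qed.

Lemma sscoefMl1 f g : coef f mon1 = 0 -> coef (f * g) mon1 = 0.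
Proof. by move=> h; rewrite sscoefM1 h mul0r. Qed.

Lemma gen_u0 i : coef (gen_u i) mon1 = 0.
Proof.
rewrite /gen_u sscoefD (sscoefMl1 _ (coefX_mon1 0)).
by rewrite (sscoefMl1 _ (coefTheta_mon1 0)) addr0.
Qed.

Lemma gen_u_even i : supp_in even_mon (gen_u i).
Proof.
apply: supp_inD.
  apply: (@supp_inM even_mon even_mon); first exact: even_closed.2.
    by apply: supp_ssX; rewrite /even_mon cardfs0.
  by apply: supp_ssX; rewrite /even_mon cardfs0.
apply: (@supp_inM (predC even_mon) (predC even_mon)).
- move=> d m dm; rewrite /= !negbK => h1 h2.
  by rewrite /even_mon (odd_card_quo dm) h1 h2.
- by apply: supp_ssTheta; rewrite /= /even_mon cardfs1.
- by apply: supp_ssTheta; rewrite /= /even_mon cardfs1.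
Qed.

Lemma gen_u_bal i : supp_in bal (gen_u i).
Proof.
pose B0 (m : supermon) := (mdeg m == 1) && (m.1 0 + (0 \in m.2) == 1)%N.
pose B1 (m : supermon) := (mdeg m == 1) && (m.1 0 + (0 \in m.2) == 0)%N.
have H d m : mdvd d m -> B0 d -> B1 (mquo m d) -> bal m.
  move=> dm /andP[/eqP h1 /eqP h2] /andP[/eqP h3 /eqP h4].
  rewrite /bal (mdeg_quo dm) h1 h3; have /mdvdP[dm1 dm2] := dm.
  have -> : (m.1 0 + (0 \in m.2) = 1)%N.
    transitivity ((d.1 0 + (0 \in d.2)) + ((mquo m d).1 0 + (0 \in (mquo m d).2)))%N;
      last by rewrite h2 h4.
    rewrite /= msetE2 inE addnACA subnKC //.
    by congr addn; have := dm2 0%N; case: (0%N \in d.2) => //= ->.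
  by [].
have s1 j : size ([mset j] : {mset nat}) = 1%N by rewrite enum_msetn.
apply: supp_inD; apply: (supp_inM H).
- by apply: supp_ssX; rewrite /B0 /mdeg /= s1 ?cardfs0 msetnxx ?inE.
- by apply: supp_ssX; rewrite /B1 /mdeg /= s1 ?cardfs0 msetnE ?inE.
- by apply: supp_ssTheta; rewrite /B0 /mdeg /= ?size_mset0 ?cardfs1 ?mset0E ?inE.
- by apply: supp_ssTheta; rewrite /B1 /mdeg /= ?size_mset0 ?cardfs1 ?mset0E ?inE.
Qed.

Lemma gen_u_nearly i : supp_in (nearly i.+1) (gen_u i).
Proof.
have H d m : mdvd d m -> predT d -> involves i.+1 (mquo m d) -> nearly i.+1 m.
  by move=> dm _ h; rewrite /nearly (involves_quo _ dm) h !orbT.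
apply: supp_inD; apply: (supp_inM H) => //.
- by apply: supp_ssX; rewrite /involves in_mset1 eqxx.
- by apply: supp_ssTheta; rewrite /involves !inE eqxx orbT.
Qed.

Definition efac i := 1 + gen_t * gen_x i + gen_tau * gen_theta i.
Definition hfac i := (1 - gen_t * gen_x i - gen_tau * gen_theta i)^-1.

Lemma efacE i : efac i = 1 + gen_u i. Proof. by rewrite /gen_u addrA. Qed.
Lemma hfacE i : hfac i = (1 - gen_u i)^-1.
Proof. by rewrite /gen_u opprD addrA. Qed.

Lemma hfac_unit i : 1 - gen_t * gen_x i - gen_tau * gen_theta i \is a GRing.unit.
Proof. by rewrite -addrA -opprD unit_geom // gen_u0. Qed.

Lemma supp_efac S i : mclosed S -> supp_in S (gen_u i) -> supp_in S (efac i).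
Proof. by move=> [S1 _] h; rewrite efacE; apply: supp_inD; first exact: supp_in1. Qed.

Lemma supp_hfac S i : mclosed S -> supp_in S (gen_u i) -> supp_in S (hfac i).
Proof. by move=> hS h; rewrite hfacE; apply: supp_in_inv; rewrite ?gen_u0. Qed.

Lemma efac_good : good efac.
Proof.
move=> i; split; first exact: (supp_efac (nearly_closed _) (@gen_u_nearly i)).
by rewrite efacE sscoefD gen_u0 sscoef1 eqxx addr0.
Qed.

Lemma hfac_good : good hfac.
Proof.
move=> i; split; first exact: (supp_hfac (nearly_closed _) (@gen_u_nearly i)).
by rewrite hfacE coef1_inv // gen_u0.
Qed.

Lemma infprod_bal F : good F -> (forall i, supp_in bal (F i)) ->
  supp_in bal (infprod F).
Proof.
move=> gF bF m bm; have [N hN] := involves_bound m.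
rewrite (infprod_coef gF hN); move: m bm {hN}.
elim: N => [|N IH]; first by rewrite big_ord0; apply: supp_in1; exact: bal_closed.1.
rewrite big_ord_recr; apply: supp_inM IH (bF N); exact: bal_closed.2.
Qed.

(* Transport of a permutation of the (x_i, theta_i) to the shifted indices. *)
Definition shiftp (s : nat -> nat) i := if i is j.+1 then (s j).+1 else 0%N.

Lemma shiftpK s g : cancel s g -> cancel (shiftp s) (shiftp g).
Proof. by move=> sK [|i] //=; rewrite sK. Qed.

Section Act.
Variables s g : nat -> nat.
Hypotheses (sK : cancel s g) (gK : cancel g s).

Lemma ss_actX i : ss_act s (ssX i) (ssX (s i)).
Proof.
move=> m /=.
have -> : ([mset s i], fset0) = mmap s ([mset i], fset0).
  apply: monP => j; rewrite ?(mmap1E sK gK) ?(mmap2E sK gK) /= ?inE //.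
  by rewrite !msetnE (can2_eq gK sK).
rewrite (inj_eq (can_inj (mmapK sK))); case: eqP => [->|_]; last by rewrite mulr0.
by rewrite /inversions big_seq_fset0 mulr1.
Qed.

Lemma ss_actTheta i : ss_act s (ssTheta i) (ssTheta (s i)).
Proof.
move=> m /=.
have -> : (mset0, [fset s i]%fset) = mmap s (mset0, [fset i]%fset).
  apply: monP => j; rewrite ?(mmap1E sK gK) ?(mmap2E sK gK) /= ?mset0E ?inE //.
  by rewrite (can2_eq gK sK).
rewrite (inj_eq (can_inj (mmapK sK))); case: eqP => [->|_]; last by rewrite mulr0.
by rewrite /inversions !big_seq_fset1 ltnn mulr1.
Qed.

Lemma ss_act_inj f h1 h2 : ss_act s f h1 -> ss_act s f h2 -> h1 = h2.
Proof.
by move=> a1 a2; apply: superseriesP => m; rewrite -(mmapK gK m) a1 a2.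
Qed.

Lemma ss_actV f h : f \is a GRing.unit -> h \is a GRing.unit ->
  ss_act s f h -> ss_act s f^-1 h^-1.
Proof.
move=> uf uh a.
pose k := SuperSeries (fun m =>
  (-1) ^+ inversions s (mmap g m).2 * coef f^-1 (mmap g m)).
have ak : ss_act s f^-1 k.
  by move=> m; rewrite -[in RHS](mmapK sK m).
have := ss_actM sK gK a ak; rewrite divrr // => a1.
have E := ss_act_inj a1 (ss_act1 sK gK).
suff -> : h^-1 = k by [].
by apply: (mulrI uh); rewrite E divrr.
Qed.

End Act.

Section ActGen.
Variables s g : nat -> nat.
Hypotheses (sK : cancel s g) (gK : cancel g s).
Let sK' := shiftpK sK.
Let gK' := shiftpK gK.

Lemma act_gen_u i : ss_act (shiftp s) (gen_u i) (gen_u (s i)).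
Proof.
apply: ss_actD; apply: (ss_actM sK' gK').
- exact: (ss_actX sK' gK' 0%N).
- exact: (ss_actX sK' gK' i.+1).
- exact: (ss_actTheta sK' gK' 0%N).
- exact: (ss_actTheta sK' gK' i.+1).
Qed.

Lemma act_efac i : ss_act (shiftp s) (efac i) (efac (s i)).
Proof.
by rewrite !efacE; apply: ss_actD (act_gen_u i); exact: ss_act1 sK' gK'.
Qed.

Lemma act_hfac i : ss_act (shiftp s) (hfac i) (hfac (s i)).
Proof.
rewrite !hfacE; apply: (ss_actV sK' gK'); rewrite ?unit_geom ?gen_u0 //.
by apply: ss_actD; [exact: ss_act1 sK' gK'|exact/ss_actN/act_gen_u].
Qed.

End ActGen.

Lemma perm_prod_comm (F : nat -> superseries) (r1 r2 : seq nat) :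
  (forall i (h : superseries), F i * h = h * F i) -> perm_eq r1 r2 ->
  \prod_(i <- r1) F i = \prod_(i <- r2) F i.
Proof.
move=> cF; elim: r1 r2 => [|x r1 IH] r2.
  by rewrite perm_sym => /perm_nilP ->.
move=> h; have xr : x \in r2 by rewrite -(perm_mem h) mem_head.
case/splitPr: xr h => p1 p2 h.
rewrite big_cons (IH (p1 ++ p2)); last first.
  by rewrite -(perm_cons x) (perm_trans h) // perm_catC /= perm_cons perm_catC.
by rewrite !big_cat big_cons /= !mulrA cF.
Qed.

Lemma infprod_act F s N g : good F ->
  (forall i, supp_in even_mon (F i)) -> cancel s g -> cancel g s ->
  (forall i, (N <= i)%N -> s i = i) ->
  (forall i, ss_act (shiftp s) (F i) (F (s i))) ->
  ss_act (shiftp s) (infprod F) (infprod F).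
Proof.
move=> gF eF sK gK sN aF m.
have [N1 h1] := involves_bound m.
have [N2 h2] := involves_bound (mmap (shiftp s) m).
pose M := maxn N (maxn N1 N2).
rewrite (@infprod_coef _ _ M gF); last first.
  by move=> i hi; apply: h2; rewrite (leq_trans _ hi) // !leq_max leqnn !orbT.
rewrite (@infprod_coef _ _ M gF); last first.
  by move=> i hi; apply: h1; rewrite (leq_trans _ hi) // !leq_max leqnn !orbT.
have aP n : ss_act (shiftp s) (\prod_(i < n) F i) (\prod_(i < n) F (s i)).
  elim: n => [|n IH].
    by rewrite !big_ord0; exact: ss_act1 (shiftpK sK) (shiftpK gK).
  rewrite !big_ord_recr /=.
  exact: ss_actM (shiftpK sK) (shiftpK gK) IH (aF n).
have sM i : (i < M)%N -> (s i < M)%N.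
  move=> iM; rewrite ltnNge; apply/negP => Msi.
  have : s i = i by apply: (can_inj sK); apply: sN; rewrite (leq_trans _ Msi) ?leq_maxl.
  by move=> E; move: iM; rewrite ltnNge -{1}E Msi.
suff E : \prod_(i < M) F (s i) = \prod_(i < M) F i by rewrite -{1}E; exact: aP.
rewrite -(big_mkord xpredT (fun i => F (s i))) -(big_mkord xpredT F) /index_iota subn0.
rewrite -(big_map s xpredT F); apply: perm_prod_comm; first by move=> i h; exact: even_comm.
have us : uniq [seq s i | i <- iota 0 M].
  by rewrite (map_inj_uniq (can_inj sK)) iota_uniq.
apply: uniq_perm => //; first exact: iota_uniq.
have sub : {subset [seq s i | i <- iota 0 M] <= iota 0 M}.
  by move=> x /mapP[i]; rewrite !mem_iota !add0n /= => /sM + ->.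
by have [|_ //] := uniq_min_size us sub; rewrite size_map.
Qed.


Section Shift.
Local Open Scope nat_scope.
Implicit Types m : supermon.

Lemma mmapS1 m i : (mmap S m).1 i = if i is j.+1 then m.1 j else 0.
Proof.
rewrite mset_seqE count_map; case: i => [|i]; last first.
  by rewrite -count_mem_mset; apply: eq_count => j /=.
by rewrite (eq_count (a2 := pred0)) ?count_pred0.
Qed.

Lemma mmapS2 m i : (i \in (mmap S m).2) = if i is j.+1 then j \in m.2 else false.
Proof.
apply/imfsetP/idP => [[j jm ->] //|]; case: i => // i im.
by exists i.
Qed.

Lemma tmon1E n m i : (tmon n m).1 i = if i is j.+1 then m.1 j else n.
Proof.
by rewrite /tmon [LHS]msetE2 mmapS1 msetnE; case: i => [|i] //=; rewrite addn0.
Qed.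

Lemma ttaumon1E n m i : (ttaumon n m).1 i = if i is j.+1 then m.1 j else n.
Proof. exact: tmon1E. Qed.

Lemma ttaumon2E n m i :
  (i \in (ttaumon n m).2) = if i is j.+1 then j \in m.2 else true.
Proof. by rewrite /ttaumon [LHS]in_fset1U mmapS2; case: i. Qed.

Lemma mdeg_mmapS m :
  (size (mmap S m).1 = size m.1) * (#|` (mmap S m).2| = #|` m.2|).
Proof.
split; first by rewrite (perm_size (perm_eq_seq_mset _)) size_map.
by rewrite card_imfset // => i j [].
Qed.

Lemma size_tmon n m : size (tmon n m).1 = n + size m.1.
Proof.
rewrite -[size m.1](mdeg_mmapS m).1 -[in RHS](size_nseq n 0) -(enum_msetn n 0) -size_cat.
apply: perm_size; apply/allP => x _ /=.
by rewrite count_cat !count_mem_mset msetE2.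
Qed.

Lemma bal_tmon n m : bal (tmon n m) = (mdeg m == n).
Proof.
rewrite /bal tmon1E mmapS2 addn0 /mdeg size_tmon (mdeg_mmapS m).2 -addnn -addnA.
by rewrite eqn_add2l.
Qed.

Lemma bal_ttaumon n m : bal (ttaumon n m) = (mdeg m == n.+1).
Proof.
rewrite /bal ttaumon1E ttaumon2E /mdeg size_tmon cardfsU1 mmapS2 /=.
by rewrite (mdeg_mmapS m).2 addnACA addn1 -addnn eqn_add2l.
Qed.

Lemma inversionsS s (I : {fset nat}) :
  inversions (shiftp s) [fset i.+1 | i in I]%fset = inversions s I.
Proof.
rewrite /inversions big_imfset /=; last by move=> x y _ _ [].
apply: eq_bigr => i _; rewrite big_imfset //=.
by move=> x y _ _ [].
Qed.

Lemma inversionsS0 s (I : {fset nat}) :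
  inversions (shiftp s) (0 |` [fset i.+1 | i in I])%fset = inversions s I.
Proof.
have h0 : 0 \notin [fset i.+1 | i in I]%fset by apply/negP => /imfsetP[].
rewrite -[RHS]inversionsS /inversions big_fsetU1 //= big1 ?add0n; last first.
  by move=> j _; rewrite ltn0 andbF.
by apply: eq_bigr => i _; rewrite big_fsetU1.
Qed.

Lemma mmap_tmon s g n m : cancel s g -> cancel g s ->
  mmap (shiftp s) (tmon n m) = tmon n (mmap s m).
Proof.
move=> sK gK; have [sK' gK'] := (shiftpK sK, shiftpK gK).
apply: monP => i.
  by rewrite (mmap1E sK' gK') !tmon1E; case: i => //= i; rewrite (mmap1E sK gK).
by rewrite (mmap2E sK' gK') !mmapS2; case: i => //= i; rewrite (mmap2E sK gK).
Qed.

Lemma mmap_ttaumon s g n m : cancel s g -> cancel g s ->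
  mmap (shiftp s) (ttaumon n m) = ttaumon n (mmap s m).
Proof.
move=> sK gK; have [sK' gK'] := (shiftpK sK, shiftpK gK).
apply: monP => i.
  by rewrite (mmap1E sK' gK') !ttaumon1E; case: i => //= i; rewrite (mmap1E sK gK).
by rewrite (mmap2E sK' gK') !ttaumon2E; case: i => //= i; rewrite (mmap2E sK gK).
Qed.

End Shift.

Lemma coef_t_sym F n : good F -> (forall i, supp_in even_mon (F i)) ->
  (forall i, supp_in bal (F i)) ->
  (forall s g i, cancel s g -> cancel g s -> ss_act (shiftp s) (F i) (F (s i))) ->
  coef_t (infprod F) n \in symsuper_pred /\ coef_ttau (infprod F) n \in symsuper_pred.
Proof.
move=> gF eF bF aF; split; apply/asboolP; split.
- exists n => m nm; apply: (infprod_bal gF bF); rewrite bal_tmon.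
  by rewrite neq_ltn nm orbT.
- move=> s [[g sK gK] [N sN]] m.
  have := infprod_act gF eF sK gK sN (fun i => aF s g i sK gK) (tmon n m).
  by rewrite (mmap_tmon _ _ sK gK) inversionsS.
- exists n.+1 => m nm; apply: (infprod_bal gF bF); rewrite bal_ttaumon.
  by rewrite neq_ltn nm orbT.
- move=> s [[g sK gK] [N sN]] m.
  have := infprod_act gF eF sK gK sN (fun i => aF s g i sK gK) (ttaumon n m).
  by rewrite (mmap_ttaumon _ _ sK gK) inversionsS0.
Qed.

Lemma gen_e_sym n :
  coef_t gen_e n \in symsuper_pred /\ coef_ttau gen_e n \in symsuper_pred.
Proof.
apply: (@coef_t_sym efac); first exact: efac_good.
- by move=> i; apply: (supp_efac even_closed); exact: gen_u_even.
- by move=> i; apply: (supp_efac bal_closed); exact: gen_u_bal.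
- by move=> s g i sK gK; exact: act_efac sK gK i.
Qed.

Lemma gen_h_sym n :
  coef_t gen_h n \in symsuper_pred /\ coef_ttau gen_h n \in symsuper_pred.
Proof.
apply: (@coef_t_sym hfac); first exact: hfac_good.
- by move=> i; apply: (supp_hfac even_closed); exact: gen_u_even.
- by move=> i; apply: (supp_hfac bal_closed); exact: gen_u_bal.
- by move=> s g i sK gK; exact: act_hfac sK gK i.
Qed.

Definition sym_e n : symsuper := SymSuper (gen_e_sym n).1.
Definition sym_etilde n : symsuper := SymSuper (gen_e_sym n).2.
Definition sym_h n : symsuper := SymSuper (gen_h_sym n).1.
Definition sym_htilde n : symsuper := SymSuper (gen_h_sym n).2.

(* Main.v *)
Require Import Defs.
From mathcomp Require Import all_boot all_order all_algebra.
From mathcomp Require Import finmap multiset boolp zify.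

(* Substituting -t, -tau in the generating series E of the e_n and etilde_n gives
   the inverse of the generating series H of the h_n and htilde_n. Comparing the
   coefficients of t^n and t^n tau in E(-t,-tau) H(t,tau) = 1 yields
     sum_k (-1)^k e_k h_(n-k) = 0   (n > 0),
     sum_k (-1)^k (e_k htilde_(n-k) - etilde_k h_(n-k)) = 0,
   and these relations are symmetric in (e, etilde) and (h, htilde) up to a global
   sign. They determine h, htilde from e, etilde, so omega exchanges both families.

   That omega^2 = 1 everywhere then follows because the e_n and etilde_n generate
   the ring. For this, order the monomials x^a theta_I by the weight
   sum_i (2 a_i + [i in I]) D^i with D large. Symmetry forces the lowest
   monomial of a nonzero symmetric series to satisfy a_(i+1) + [i+1 in I] <= a_i,
   and each such monomial is, up to sign, the lowest one of a product of e_n's and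
   etilde_n's, whose lowest monomials are x_0...x_(n-1) and
   x_0...x_(n-1) theta_n. Subtracting a multiple of that product raises the
   weight, which is bounded by D^N in degree at most N. *)

Set Implicit Arguments.
Unset Strict Implicit.
Unset Printing Implicit Defensive.

Import GRing.Theory.

Local Open Scope mset_scope.

(** * Monomials as base-D numbers, and the effect of adjacent transpositions *)

Section Weight.
Local Open Scope nat_scope.
Implicit Types (m d : supermon) (D M N i k : nat).

Lemma size_mset_ge (a : {mset nat}) i : a i <= size a.
Proof. by rewrite -count_mem_mset count_size. Qed.

Lemma digits_inj D M (c c' : nat -> nat) :
  (forall i, c i < D) -> (forall i, c' i < D) ->
  \sum_(i < M) c i * D ^ i = \sum_(i < M) c' i * D ^ i ->
  forall i, i < M -> c i = c' i.
Proof.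
elim: M c c' => [|M IH] c c' hc hc' //.
rewrite !big_ord_recl /= !expn0 !muln1.
have E (b : nat -> nat) : \sum_(i < M) b (bump 0 i) * D ^ bump 0 i
    = (\sum_(i < M) b i.+1 * D ^ i) * D.
  by rewrite big_distrl /=; apply: eq_bigr => i _; rewrite expnSr mulnA.
rewrite !E => eqs.
have D0 : 0 < D by apply: leq_ltn_trans (hc 0).
have e0 : c 0 = c' 0.
  by have := congr1 (modn^~ D) eqs; rewrite !(addnC (_ 0)) !modnMDl !modn_small.
move: eqs; rewrite e0 => /addnI/eqP; rewrite eqn_pmul2r // => /eqP eqs.
case=> [//|i]; rewrite ltnS.
by apply: (IH (c \o S) (c' \o S)) => // j /=.
Qed.

Lemma digits_lt D M (c : nat -> nat) : (forall i, c i < D) ->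
  \sum_(i < M) c i * D ^ i < D ^ M.
Proof.
move=> hc; elim: M => [|M IH]; first by rewrite big_ord0.
rewrite big_ord_recr /= expnS; apply: leq_trans (_ : (c M).+1 * D ^ M <= _).
  by rewrite mulSn ltn_add2r.
by rewrite leq_mul2r hc orbT.
Qed.

(** Doubling the exponent of x_i leaves the parity free for theta_i, so one number records both, and
    it is additive when a monomial is split into two factors. *)
Definition digit m i := (m.1 i).*2 + (i \in m.2).

Lemma digit_quo d m i : mdvd d m -> digit m i = digit d i + digit (mquo m d) i.
Proof.
move=> /mdvdP[h1 h2]; rewrite /digit /= msetE2 inE.
have := h1 i; have := h2 i.
by case: (i \in d.2) => [/(_ isT) ->|_] /=; lia.
Qed.

Lemma digit_eq m d : digit m =1 digit d -> m = d.
Proof.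
move=> h; apply: monP => i; have := h i; rewrite /digit;
  by case: (i \in m.2); case: (i \in d.2) => //; lia.
Qed.

(** Any D above twice the degree thus turns the digits into genuine base-D digits. *)
Lemma digit_le m i : digit m i <= (mdeg m).*2.
Proof.
rewrite /digit /mdeg doubleD leq_add ?leq_double ?size_mset_ge //.
case: (boolP (i \in m.2)) => // im.
by rewrite (@leq_trans (#|` m.2|)) // -?addnn ?leq_addr // cardfs_gt0; apply/fset0Pn; exists i.
Qed.

Definition index_bound m := (\max_(j <- m.1) j + \max_(j <- m.2) j).+1.

Lemma digit_bound m i : index_bound m <= i -> digit m i = 0.
Proof.
move=> hi; rewrite /digit.
have /negPf -> : i \notin m.2.
  apply/negP => h; have := @leq_bigmax_seq _ _ xpredT id _ h isT.
  by rewrite leqNgt (leq_trans _ hi) // ltnS leq_addl.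
case: (posnP (m.1 i)) => [->//|h]; have {}h : i \in m.1 by rewrite in_mset.
have := @leq_bigmax_seq _ _ xpredT id _ h isT.
by rewrite leqNgt (leq_trans _ hi) // ltnS leq_addr.
Qed.

Definition weight D m := \sum_(i < index_bound m) digit m i * D ^ i.

(** Allows the weights of different monomials to be written over a common index range. *)
Lemma weightE D M m : (forall i, M <= i -> digit m i = 0) ->
  weight D m = \sum_(i < M) digit m i * D ^ i.
Proof.
have E K L : (forall i, K <= i -> digit m i = 0) -> K <= L ->
    \sum_(i < K) digit m i * D ^ i = \sum_(i < L) digit m i * D ^ i.
  move=> h KL; rewrite (big_ord_widen L (fun i => digit m i * D ^ i)) // big_mkcond.
  by apply: eq_bigr => i _; case: ltnP => // /h ->.
move=> h; rewrite /weight (E _ (maxn (index_bound m) M) (@digit_bound m)) ?leq_maxl //.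
by rewrite (E M (maxn (index_bound m) M)) ?leq_maxr.
Qed.

Lemma weight_quo D d m : mdvd d m -> weight D m = weight D d + weight D (mquo m d).
Proof.
move=> dm; have h i : index_bound m <= i -> digit d i = 0 /\ digit (mquo m d) i = 0.
  by move/digit_bound; rewrite (digit_quo i dm); lia.
rewrite [weight D d](@weightE _ (index_bound m)); last by move=> i /h[].
rewrite [weight D (mquo m d)](@weightE _ (index_bound m)); last by move=> i /h[].
by rewrite -big_split; apply: eq_bigr => i _ /=; rewrite (digit_quo i dm) mulnDl.
Qed.

Lemma weight_inj D m d : (mdeg m).*2 < D -> (mdeg d).*2 < D ->
  weight D m = weight D d -> m = d.
Proof.
move=> hm hd; pose M := maxn (index_bound m) (index_bound d).
have bm i : M <= i -> digit m i = 0 by rewrite geq_max => /andP[/digit_bound].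
have bd i : M <= i -> digit d i = 0 by rewrite geq_max => /andP[_ /digit_bound].
rewrite (weightE D bm) (weightE D bd) => E.
apply: digit_eq => i; have [iM|iM] := leqP M i; first by rewrite bm ?bd.
by apply: (digits_inj _ _ E iM) => j; exact: leq_ltn_trans (digit_le _ _) _.
Qed.

Definition swap_next i k := if k == i then i.+1 else if k == i.+1 then i else k.

Lemma swap_nextK i : involutive (swap_next i).
Proof. by move=> k; rewrite /swap_next; do !case: eqP => //; lia. Qed.

Lemma swap_next_finite i : finite_perm (swap_next i).
Proof.
split; first by exists (swap_next i); exact: swap_nextK.
by exists i.+2 => k ki; rewrite /swap_next; do !case: eqP => //; lia.
Qed.

Lemma digit_swap_next i m k :
  digit (mmap (swap_next i) m) k = digit m (swap_next i k).
Proof.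
have K := @swap_nextK i.
by rewrite /digit (mmap1E K K) (mmap2E K K).
Qed.

(** Only the places i and i + 1 change. For digits x < y there, the claim is y + x D < x + y D,
    multiplied by D^i. *)
Lemma weight_swap_next D i m : 1 < D -> digit m i < digit m i.+1 ->
  weight D (mmap (swap_next i) m) < weight D m.
Proof.
move=> D1 lt; pose M := i.+2 + index_bound m.
have bm k : M <= k -> digit m k = 0 by move=> h; apply: digit_bound; lia.
rewrite (weightE D bm) (@weightE D M); last first.
  move=> k h; rewrite digit_swap_next bm // /swap_next.
  by do !case: eqP => //; lia.
rewrite -(big_mkord xpredT (fun k => digit (mmap (swap_next i) m) k * D ^ k)).
rewrite -(big_mkord xpredT (fun k => digit m k * D ^ k)).
have iM : i.+2 <= M by exact: leq_addr.
rewrite !(@big_cat_nat _ _ _ i.+2 0 M) //= (@eq_big_nat _ _ _ i.+2 M _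
  (fun k => digit m k * D ^ k)) => [|k /andP[h _]]; last first.
  by rewrite digit_swap_next /swap_next; do !case: eqP => //; lia.
rewrite ltn_add2r !big_nat_recr //= (@eq_big_nat _ _ _ 0 i _
  (fun k => digit m k * D ^ k)) => [|k /andP[_ h]]; last first.
  by rewrite digit_swap_next /swap_next; do !case: eqP => //; lia.
rewrite -!addnA ltn_add2l !digit_swap_next /swap_next !eqxx.
have -> : (i.+1 == i) = false by lia.
rewrite expnS; have : 0 < D ^ i by rewrite expn_gt0 (ltnW D1).
move: (digit m i) (digit m i.+1) (D ^ i) lt => x y z lt z0.
rewrite !mulnA -!mulnDl ltn_pmul2r // -(subnKC (ltnW lt)) mulnDl.
have : y - x < (y - x) * D by rewrite ltn_Pmulr // subn_gt0.
by move: (x * D) (_ * D) => u v; lia.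
Qed.

End Weight.

Local Open Scope ring_scope.

(** * Lowest monomials of symmetric series and of products *)

Section Lowest.
Implicit Types (m d : supermon) (f g : superseries) (D N i : nat).

(* The monomials that occur as lowest monomials of products of the e_n and
   of distinct etilde_n. *)
Definition admissible m := forall i, (m.1 i.+1 + (i.+1 \in m.2) <= m.1 i)%N.

(** The pair (i, i + 1) is the only one that the swap inverts, so theta_I changes sign when it
    contains both variables. *)
Lemma inversions_swap_next i (I : {fset nat}) :
  i \in I -> i.+1 \in I -> inversions (swap_next i) I = 1%N.
Proof.
move=> iI i1I; rewrite /inversions (big_fsetD1 i) //= (big_fsetD1 i.+1) //=.
have -> : swap_next i i = i.+1 by rewrite /swap_next eqxx.
have -> : swap_next i i.+1 = i by rewrite /swap_next eqxx; case: eqP => //; lia.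
rewrite !ltnSn /= -addnA [X in (1 + X)%N](_ : _ = 0)%N //.
apply/eqP; rewrite addn_eq0; apply/andP; split; apply/eqP; rewrite big_seq_cond.
  rewrite big1 // => j; rewrite !inE andbT => /andP[/eqP ji _]; apply/eqP.
  by rewrite eqb0 /swap_next; do !case: eqP => //; lia.
rewrite big1 // => j; rewrite !inE andbT => /andP[/eqP ji _].
rewrite big1 // => k _; apply/eqP.
by rewrite eqb0 /swap_next; do !case: eqP => //; lia.
Qed.

(** An increase of the digits from i to i + 1 would let the swap produce a lower monomial of f.
    Nonincreasing digits give admissibility except when a_i = a_(i+1) and both thetas occur; then
    the swap fixes m and negates its coefficient, which would have to be 0. *)
Lemma lowest_admissible D f m : (1 < D)%N -> ss_symmetric f -> coef f m != 0 ->
  (forall d, coef f d != 0 -> weight D m <= weight D d)%N -> admissible m.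
Proof.
move=> D1 symf fm low i.
have act := symf _ (swap_next_finite i) m.
have le : (digit m i.+1 <= digit m i)%N.
  rewrite leqNgt; apply/negP => /(weight_swap_next D1); rewrite ltnNge => /negP.
  by apply; apply: low; rewrite act mulf_neq0 // signr_eq0.
suff : ~ ((i \in m.2) && (i.+1 \in m.2) && (m.1 i == m.1 i.+1)).
  by move: le; rewrite /digit; case: (i \in m.2); case: (i.+1 \in m.2) => /=; lia.
move=> /andP[/andP[im i1m] /eqP eqm].
move: act; rewrite inversions_swap_next // expr1 mulN1r.
have -> : mmap (swap_next i) m = m.
  apply: digit_eq => k; rewrite digit_swap_next /swap_next.
  case: eqP => [->|_]; first by rewrite /digit im i1m eqm.
  by case: eqP => [->|_] //; rewrite /digit im i1m eqm.
by move: fm; lia.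
Qed.

Lemma exists_lowest D f m : coef f m != 0 -> exists2 m0, coef f m0 != 0 &
  (forall d, coef f d != 0 -> weight D m0 <= weight D d)%N.
Proof.
move=> fm.
have ex : exists n, `[< exists2 d, coef f d != 0 & weight D d = n >].
  by exists (weight D m); apply/asboolP; exists m.
case: (ex_minnP ex) => n /asboolP[d fd <-] h; exists d => // d' fd'.
by apply: h; apply/asboolP; exists d'.
Qed.

(** The x-exponents of an admissible monomial are nonincreasing, and r is the first index where they
    vanish. A factor theta_(i+1) forces a_i > 0, hence i + 1 <= r. *)
Lemma admissible_support m : admissible m ->
  exists r, (forall i, (0 < m.1 i)%N = (i < r)%N) /\
            (forall i, i \in m.2 -> (i <= r)%N).
Proof.
move=> adm.
have ex : exists r, m.1 r == 0%N.
  exists (index_bound m); have := digit_bound (leqnn (index_bound m)).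
  by rewrite /digit; case: (_ \in _) => /=; lia.
case: (ex_minnP ex) => r /eqP r0 minr; exists r.
have z i : (r <= i)%N -> m.1 i = 0%N.
  elim: i => [|i IH]; first by rewrite leqn0 => /eqP r0'; rewrite -[X in m.1 X]r0'.
  rewrite leq_eqVlt => /orP[/eqP <- //|/IH E]; have := adm i; lia.
split=> i; first last.
  case: i => // i im; have := adm i; rewrite im => h.
  by rewrite ltnNge; apply/negP => /z E; move: h; rewrite E; lia.
case: (ltnP i r) => [ir|/z -> //]; rewrite lt0n; apply/negP => /minr.
by rewrite leqNgt ir.
Qed.

Definition xrange r : {mset nat} := seq_mset (iota 0 r).

Lemma xrangeE r i : xrange r i = (i < r)%N.
Proof. by rewrite mset_seqE count_uniq_mem ?iota_uniq // mem_iota. Qed.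

Lemma size_xrange r : size (xrange r) = r.
Proof. by rewrite (perm_size (perm_eq_seq_mset _)) size_iota. Qed.

Lemma leq_size_mset (a b : {mset nat}) : (forall i, a i <= b i)%N ->
  (size a <= size b)%N.
Proof.
move=> h; have ab : mdvd (a, fset0) (b, fset0) by apply/mdvdP; split.
by have := mdvd_deg ab; rewrite /mdeg leq_add2r.
Qed.

(** The variables x_0, ..., x_(r-1) already use degree r, and a theta, whose index is at most r,
    uses one more. *)
Lemma admissible_digit0 m : admissible m ->
  forall i, (mdeg m <= i)%N -> digit m i = 0%N.
Proof.
move=> adm i; have [r [h1 h2]] := admissible_support adm.
have rs : (r <= size m.1)%N.
  rewrite -[r in (r <= _)%N]size_xrange; apply: leq_size_mset => j.
  by rewrite xrangeE -h1; case: (m.1 j).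
rewrite /mdeg => hi.
have E : m.1 i = 0%N by apply/eqP; rewrite -leqn0 leqNgt h1; lia.
rewrite /digit E; case: (boolP (i \in m.2)) => // im.
have : (0 < #|` m.2|)%N by rewrite cardfs_gt0; apply/fset0Pn; exists i.
by have := h2 _ im; lia.
Qed.

(** This bound on lowest monomials makes the elimination in [symsuper_generated] stop. *)
Lemma weight_admissible N m D : admissible m -> (mdeg m <= N)%N -> (N.*2 < D)%N ->
  (weight D m < D ^ N)%N.
Proof.
move=> adm mN ND; rewrite (@weightE D N) => [|i Ni].
  by apply: digits_lt => i; have := digit_le m i; lia.
by apply: admissible_digit0 => //; exact: leq_trans Ni.
Qed.

(** The square condition says that the coefficient is 1 or -1; crossings of thetas in products make
    the sign vary. Strictness of the minimum is left to [weight_inj]. *)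
Definition low_term D f m := coef f m ^+ 2 = 1 /\
  forall d, coef f d != 0 -> (weight D m <= weight D d)%N.

Lemma sscoefM_neq0 f g m : coef (f * g) m != 0 ->
  exists2 d, mdvd d m & (coef f d != 0) && (coef g (mquo m d) != 0).
Proof.
move=> h; apply: contrapT => no; case/eqP: h.
rewrite sscoefM big_seq big1 // => d; rewrite mem_mdivs => dm.
apply: contrapT => /eqP; rewrite !mulf_eq0 signr_eq0 /= negb_or => nz.
by apply: no; exists d.
Qed.

Lemma sscoefM_single f g m d : mdvd d m ->
  (forall d', mdvd d' m -> coef f d' != 0 -> coef g (mquo m d') != 0 -> d' = d) ->
  coef (f * g) m = (-1) ^+ crossings d.2 (mquo m d).2 * (coef f d * coef g (mquo m d)).
Proof.
move=> dm uniq_d; rewrite sscoefM (big_fsetD1 d) /= ?mem_mdivs //.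
rewrite [X in _ + X]big_seq big1 ?addr0 // => d'.
rewrite in_fsetD1 mem_mdivs => /andP[d'd d'm].
apply/eqP; rewrite mulf_eq0 signr_eq0 /= mulf_eq0.
by apply: contraNT d'd; rewrite negb_or => /andP[h1 h2]; apply/eqP/uniq_d.
Qed.

(** Weights add up, so in any factorization of m contributing to the product both factors have
    minimal weight. By [weight_inj] it is the given one, and the coefficient is a single signed
    product. *)
Lemma low_termM D f g d m : ((mdeg m).*2 < D)%N -> mdvd d m ->
  low_term D f d -> low_term D g (mquo m d) -> low_term D (f * g) m.
Proof.
move=> mD dm [fd lf] [gq lg]; split.
  rewrite (sscoefM_single dm) => [|d' d'm /lf h1 /lg h2].
    by rewrite !exprMn fd gq -exprM mulnC exprM sqrrN !expr1n !mulr1.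
  have E := weight_quo D dm; rewrite (weight_quo D d'm) in E.
  apply: (@weight_inj D); last by lia.
    by have := mdvd_deg d'm; lia.
  by have := mdvd_deg dm; lia.
move=> m' /sscoefM_neq0[d' d'm /andP[/lf h1 /lg h2]].
by rewrite (weight_quo D dm) (weight_quo D d'm) leq_add.
Qed.

Lemma low_term1 D : low_term D 1 mon1.
Proof.
split; first by rewrite sscoef1 eqxx expr1n.
by move=> d; have [->|] := eqVneq d mon1 => //; rewrite sscoef1 => /negPf ->.
Qed.

End Lowest.

(** * Coefficients of finite products of the factors 1 + t x_i + tau theta_i *)

Section Factors.
Implicit Types (m d e : supermon) (f g : superseries) (n N i : nat).

Lemma mon1_1E i : mon1.1 i = 0%N. Proof. exact: mset0E. Qed.
Lemma mon1_2E i : (i \in mon1.2) = false. Proof. exact: in_fset0. Qed.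

Lemma mquo_mul d e : (forall i, i \in d.2 -> i \notin e.2) -> mquo (mmul d e) d = e.
Proof.
move=> dis; apply: monP => i; first by rewrite [LHS]msetE2 msetE2 addKn.
by rewrite [LHS]in_fsetD in_fsetU; have := dis i; case: (i \in d.2) => //= /(_ isT) /negPf ->.
Qed.

Lemma sscoef_monoM d e f g m :
  (forall c, coef f c = (c == d)%:R) -> (forall c, coef g c = (c == e)%:R) ->
  (forall i, i \in d.2 -> i \notin e.2) -> crossings d.2 e.2 = 0%N ->
  coef (f * g) m = (m == mmul d e)%:R.
Proof.
move=> fd ge dis cr0; have [->|mde] := eqVneq m (mmul d e); last first.
  apply: contra_neq_eq mde => /sscoefM_neq0[c cm]; rewrite fd ge.
  have [ec|_] := eqVneq c d => //; have [<- _|_] := eqVneq (mquo m c) e => //.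
  by rewrite -ec mmul_quo.
have dde : mdvd d (mmul d e).
  by apply/mdvdP; split=> i /=; rewrite ?msetE2 ?leq_addr // !inE => ->.
rewrite (sscoefM_single dde) => [|d' _]; last by rewrite fd; have [] := eqVneq d' d.
by rewrite (mquo_mul dis) fd ge !eqxx cr0.
Qed.

Lemma in_mquo m d i : (i \in (mquo m d).2) = (i \notin d.2) && (i \in m.2).
Proof. exact: in_fsetD. Qed.

Lemma mquo1E m d i : (mquo m d).1 i = (m.1 i - d.1 i)%N.
Proof. by rewrite /= msetE2. Qed.

Lemma tmon_fset0 n (a : {mset nat}) : (tmon n (a, fset0)).2 = fset0.
Proof. by apply/fsetP => i; rewrite mmapS2 in_fset0; case: i => // i; rewrite in_fset0. Qed.

(** The monomials t x_n and tau theta_n, in the shifted indices of the generating series. *)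
Definition txmon n : supermon := tmon 1 ([mset n], fset0).
Definition tauthetamon n : supermon := ttaumon 0 (mset0, [fset n]%fset).

Lemma sscoefX i m : coef (ssX i) m = (m == ([mset i], fset0))%:R. Proof. by []. Qed.
Lemma sscoefTheta i m : coef (ssTheta i) m = (m == (mset0, [fset i]%fset))%:R.
Proof. by []. Qed.

Lemma txmonE n : txmon n = mmul ([mset 0%N], fset0) ([mset n.+1], fset0).
Proof.
apply: monP => i.
  by rewrite [RHS]msetE2 tmon1E; case: i => [|i]; rewrite !msetnE ?eqSS.
by rewrite [RHS]in_fsetU mmapS2; case: i => [|i]; rewrite !inE.
Qed.

Lemma tauthetamonE n :
  tauthetamon n = mmul (mset0, [fset 0%N]%fset) (mset0, [fset n.+1]%fset).
Proof.
apply: monP => i.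
  by rewrite [RHS]msetE2 ttaumon1E !mset0E; case: i => [|i]; rewrite ?mset0E.
by rewrite [RHS]in_fsetU ttaumon2E !inE; case: i => [|i]; rewrite ?inE.
Qed.

Lemma coef_gen_tx n m : coef (gen_t * gen_x n) m = (m == txmon n)%:R.
Proof.
rewrite txmonE; apply: sscoef_monoM; [exact: sscoefX|exact: sscoefX| |].
  by move=> i; rewrite in_fset0.
exact: crossings0l.
Qed.

Lemma coef_gen_tautheta n m :
  coef (gen_tau * gen_theta n) m = (m == tauthetamon n)%:R.
Proof.
rewrite tauthetamonE; apply: sscoef_monoM; [exact: sscoefTheta|exact: sscoefTheta| |].
  by move=> i; rewrite !inE => /eqP ->.
by rewrite /crossings !big_seq_fset1.
Qed.

Lemma coef_gen_u n m :
  coef (gen_u n) m = (m == txmon n)%:R + (m == tauthetamon n)%:R.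
Proof. by rewrite /gen_u sscoefD coef_gen_tx coef_gen_tautheta. Qed.

Lemma coef_efac_neq0 n m : coef (efac n) m != 0 ->
  [|| m == mon1, m == txmon n | m == tauthetamon n].
Proof.
apply: contraNT; rewrite !negb_or => /and3P[/negPf h1 /negPf h2 /negPf h3].
by rewrite efacE sscoefD sscoef1 coef_gen_u h1 h2 h3.
Qed.

Lemma txmon1E n i : (txmon n).1 i = ((i == 0) + (i == n.+1))%N.
Proof. by rewrite tmon1E; case: i => [|i]; rewrite ?msetnE ?eqSS; case: eqP. Qed.

Lemma txmon2E n i : (i \in (txmon n).2) = false.
Proof. by rewrite tmon_fset0 in_fset0. Qed.

Lemma tauthetamon1E n i : (tauthetamon n).1 i = 0%N.
Proof. by rewrite ttaumon1E; case: i => [|i] //; rewrite mset0E. Qed.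

Lemma tauthetamon2E n i : (i \in (tauthetamon n).2) = (i == 0%N) || (i == n.+1).
Proof. by rewrite ttaumon2E; case: i => [|i] //; rewrite !inE. Qed.

Definition mons1E := (txmon1E, txmon2E, tauthetamon1E, tauthetamon2E, mon1_1E, mon1_2E).

(** Factor i supplies at most one of x_i and theta_i, and no other factor contains them. The boolean
    i < n counts as 0 or 1. *)
Lemma coef_efac_prod_neq0 n m : coef (\prod_(i < n) efac i) m != 0 ->
  forall i, (m.1 i.+1 + (i.+1 \in m.2) <= (i < n))%N.
Proof.
elim: n m => [|n IH] m.
  rewrite big_ord0 sscoef1; have [-> _ i|//] := eqVneq m mon1.
  by rewrite mon1_1E mon1_2E.
rewrite big_ord_recr => /sscoefM_neq0[d /mdvdP[h1 h2] /andP[/IH hd /coef_efac_neq0]].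
move=> hq i; have := hd i; have := h1 i.+1; have := h2 i.+1; rewrite ltnS.
have E1 : (mquo m d).1 i.+1 = (m.1 i.+1 - d.1 i.+1)%N by rewrite [LHS]msetE2.
have E2 : (i.+1 \in (mquo m d).2) = (i.+1 \notin d.2) && (i.+1 \in m.2) by rewrite inE.
case/or3P: hq => /eqP hq; rewrite hq ?mons1E in E1 E2; move: E1 E2.
- by case: (i.+1 \in d.2); case: (i.+1 \in m.2) => //=; lia.
- rewrite eqSS; case: (i =P n) => [->|]; rewrite ?ltnn;
    by case: (_ \in d.2); case: (_ \in m.2) => //=; lia.
- by case: (i.+1 \in d.2); case: (i.+1 \in m.2) => //=; lia.
Qed.

(** Only the last factor contains x_n and theta_n. Since m contains exactly one of them, the last
    factor must contribute the term q. *)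
Lemma coef_efac_prodS n m q : mdvd q m -> q = txmon n \/ q = tauthetamon n ->
  (m.1 n.+1 + (n.+1 \in m.2) = 1)%N ->
  coef (\prod_(i < n.+1) efac i) m
  = (-1) ^+ crossings (mquo m q).2 q.2 * coef (\prod_(i < n) efac i) (mquo m q).
Proof.
move=> qm hq hm; have dm := mdvd_quo m q.
rewrite big_ord_recr (sscoefM_single dm) => [|d dvm /coef_efac_prod_neq0/(_ n)].
  rewrite mquoK // efacE sscoefD sscoef1 coef_gen_u.
  suff -> : (q == mon1)%:R + ((q == txmon n)%:R + (q == tauthetamon n)%:R) = 1 :> int.
    by rewrite mulr1.
  have n1 : (txmon n == mon1) = false.
    by apply/eqP => /(congr1 (fun p : supermon => p.1 0%N)); rewrite !mons1E.
  have n2 : (tauthetamon n == mon1) = false.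
    by apply/eqP => /(congr1 (fun p : supermon => 0%N \in p.2)); rewrite !mons1E.
  have n3 : (txmon n == tauthetamon n) = false.
    by apply/eqP => /(congr1 (fun p : supermon => p.1 0%N)); rewrite !mons1E.
  by case: hq => ->; rewrite ?n1 ?n2 eqxx ?n3 // eq_sym n3.
rewrite ltnn leqn0 addn_eq0 => /andP[/eqP d1 d2] /coef_efac_neq0 hq'.
rewrite -(mquoK dvm); congr mquo.
have E1 : (mquo m d).1 n.+1 = m.1 n.+1 by rewrite [LHS]msetE2 d1 subn0.
have E2 : (n.+1 \in (mquo m d).2) = (n.+1 \in m.2).
  by rewrite inE; case: (_ \in d.2) d2.
have /mdvdP[/(_ n.+1) q1 /(_ n.+1) q2] := qm.
case/or3P: hq' => /eqP hq'; rewrite hq' in E1 E2 *; move: E1 E2 q1 q2.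
- by rewrite !mons1E => E1 E2; move: hm; rewrite -E1 -E2.
- rewrite !mons1E eqxx => E1 E2 _; case: hq => [->|->]; first by [].
  by rewrite tauthetamon2E eqxx orbT => /(_ isT); rewrite -E2; discriminate.
- rewrite !mons1E eqxx => E1 E2; case: hq => [->|->]; last by [].
  by rewrite mons1E eqxx -E1.
Qed.

Lemma coef_efac_prod_top n :
  coef (\prod_(i < n) efac i) (tmon n (xrange n, fset0)) = 1.
Proof.
elim: n => [|n IH].
  rewrite big_ord0 sscoef1; suff -> : tmon 0 (xrange 0, fset0) = mon1 by rewrite eqxx.
  apply: monP => i; first by rewrite tmon1E mons1E; case: i => // i; rewrite xrangeE.
  by rewrite tmon_fset0.
have qm : mdvd (txmon n) (tmon n.+1 (xrange n.+1, fset0)).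
  apply/mdvdP; split=> i; last by rewrite mons1E.
  by rewrite mons1E tmon1E; case: i => [|i] //=; rewrite xrangeE eqSS ltnS; case: (ltngtP i n).
rewrite (coef_efac_prodS qm); [|by left|]; last first.
  by rewrite tmon1E mmapS2 xrangeE ltnSn inE.
have -> : mquo (tmon n.+1 (xrange n.+1, fset0)) (txmon n) = tmon n (xrange n, fset0).
  apply: monP => i.
    rewrite mquo1E txmon1E !tmon1E; case: i => [|i]; first by rewrite subn1.
    by rewrite !xrangeE eqSS ltnS; case: (ltngtP i n).
  by rewrite in_mquo txmon2E.
by rewrite IH mulr1 [(txmon n).2]tmon_fset0 crossings0r.
Qed.

(** The last factor supplies tau theta_n and the earlier ones the t x_i; the latter carry no theta,
    so no sign arises. *)
Lemma coef_efac_prod_ttop n :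
  coef (\prod_(i < n.+1) efac i) (ttaumon n (xrange n, [fset n]%fset)) = 1.
Proof.
set m := ttaumon _ _.
have qm : mdvd (tauthetamon n) m.
  apply/mdvdP; split=> i; first by rewrite mons1E.
  by rewrite tauthetamon2E.
rewrite (coef_efac_prodS qm); [|by right|]; last first.
  by rewrite ttaumon1E ttaumon2E xrangeE ltnn inE eqxx.
have -> : mquo m (tauthetamon n) = tmon n (xrange n, fset0).
  apply: monP => i.
    by rewrite mquo1E tauthetamon1E subn0.
  by rewrite in_mquo tmon_fset0 in_fset0 tauthetamon2E andNb.
by rewrite tmon_fset0 crossings0l mul1r coef_efac_prod_top.
Qed.

End Factors.

(** * Supports and lowest terms of e_n and etilde_n *)

Section Supports.
Implicit Types (m d : supermon) (f : superseries) (S : pred supermon).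

Lemma infprod_supp F S : good F -> mclosed S -> (forall i, supp_in S (F i)) ->
  supp_in S (infprod F).
Proof.
move=> gF cS sF m Sm; have [N hN] := involves_bound m.
rewrite (infprod_coef gF hN); move: m Sm {hN}.
elim: N => [|N IH]; first by rewrite big_ord0; apply: supp_in1; exact: cS.1.
rewrite big_ord_recr; apply: supp_inM IH (sF N); exact: cS.2.
Qed.

(* The degree in theta equals the degree in tau. *)
Definition theta_bal m := #|` m.2| == (0%N \in m.2).*2.

Lemma theta_bal_closed : mclosed theta_bal.
Proof.
split=> [|d m dm]; first by rewrite /theta_bal mon1_2E cardfs0.
move=> /eqP h1 /eqP h2; rewrite /theta_bal.
have [_ /andP[_ sub]] := (dm, dm).
rewrite (perm_size (perm_fsetD sub)) size_cat h1 [X in (_ + X)%N]h2 -doubleD.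
rewrite (inj_eq double_inj) in_mquo; have := fsubsetP sub 0%N.
by case: (_ \in d.2) => [/(_ isT) ->|] //=.
Qed.

Lemma gen_u_theta_bal i : supp_in theta_bal (gen_u i).
Proof.
move=> m; rewrite coef_gen_u => hm.
have /negPf -> : m != txmon i.
  by apply: contraNneq hm => ->; rewrite /theta_bal [(txmon i).2]tmon_fset0 cardfs0 in_fset0.
have /negPf -> // : m != tauthetamon i.
apply: contraNneq hm => ->; rewrite /theta_bal tauthetamon2E.
have -> : (tauthetamon i).2 = [fset 0%N; i.+1]%fset.
  by apply/fsetP => j; rewrite tauthetamon2E !inE.
by rewrite cardfs2.
Qed.

Lemma gen_e_supp S : mclosed S -> (forall i, supp_in S (gen_u i)) -> supp_in S gen_e.
Proof.
move=> cS sS; apply: (infprod_supp efac_good) => // i; exact: supp_efac.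
Qed.

Lemma gen_h_supp S : mclosed S -> (forall i, supp_in S (gen_u i)) -> supp_in S gen_h.
Proof.
move=> cS sS; apply: (infprod_supp hfac_good) => // i; exact: supp_hfac.
Qed.

Lemma coef_t_theta G n m : supp_in theta_bal G -> coef (coef_t G n) m != 0 -> m.2 = fset0.
Proof.
move=> bG h; have : theta_bal (tmon n m) by apply: contraNT h => /bG /= ->.
rewrite /theta_bal mmapS2 => /eqP; rewrite (mdeg_mmapS m).2 => /eqP.
by rewrite cardfs_eq0 => /eqP.
Qed.

Lemma coef_ttau_theta G n m : supp_in theta_bal G -> coef (coef_ttau G n) m != 0 ->
  #|` m.2| = 1%N.
Proof.
move=> bG h; have : theta_bal (ttaumon n m) by apply: contraNT h => /bG /= ->.
have E : #|` (ttaumon n m).2| = #|` m.2|.+1.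
  by rewrite cardfsU1 mmapS2 (mdeg_mmapS m).2.
by rewrite /theta_bal ttaumon2E E => /eqP[].
Qed.

Lemma coef_t_deg G n m : supp_in bal G -> coef (coef_t G n) m != 0 -> mdeg m = n.
Proof.
by move=> bG h; apply/eqP; rewrite -bal_tmon; apply: contraNT h => /bG /= ->.
Qed.

Lemma coef_ttau_deg G n m : supp_in bal G -> coef (coef_ttau G n) m != 0 -> mdeg m = n.+1.
Proof.
by move=> bG h; apply/eqP; rewrite -bal_ttaumon; apply: contraNT h => /bG /= ->.
Qed.

Lemma gen_e_sqfree m i : coef gen_e m != 0 -> (m.1 i.+1 + (i.+1 \in m.2) <= 1)%N.
Proof.
have [N hN] := involves_bound m.
rewrite (infprod_coef efac_good hN) => /coef_efac_prod_neq0/(_ i).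
by case: (i < N)%N => // /leq_trans ->.
Qed.

Definition gen_e_bal := gen_e_supp bal_closed gen_u_bal.
Definition gen_h_bal := gen_h_supp bal_closed gen_u_bal.
Definition gen_e_theta_bal := gen_e_supp theta_bal_closed gen_u_theta_bal.
Definition gen_h_theta_bal := gen_h_supp theta_bal_closed gen_u_theta_bal.

Lemma coef_e_top n : coef (coef_t gen_e n) (xrange n, fset0) = 1.
Proof.
rewrite -(coef_efac_prod_top n); apply: (infprod_coef efac_good) => i ni.
rewrite /involves in_mset tmon1E tmon_fset0 in_fset0 xrangeE; lia.
Qed.

Lemma coef_etilde_top n : coef (coef_ttau gen_e n) (xrange n, [fset n]%fset) = 1.
Proof.
rewrite -(coef_efac_prod_ttop n); apply: (infprod_coef efac_good) => i ni.
rewrite /involves in_mset ttaumon1E ttaumon2E inE xrangeE; lia.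
Qed.

(** The x-part is x_0 ... x_(r-1). A theta has index at most r and shares no index with the x-part,
    so its index is r. *)
Lemma admissible_sqfree m : admissible m -> (forall i, m.1 i + (i \in m.2) <= 1)%N ->
  m.1 = xrange (size m.1) /\ forall i, i \in m.2 -> i = size m.1.
Proof.
move=> adm sq; have [r [h1 h2]] := admissible_support adm.
have E : m.1 = xrange r.
  by apply/msetP => i; rewrite xrangeE -h1; have := sq i; case: (m.1 i) => [|[]].
have Er : size m.1 = r by rewrite E size_xrange.
rewrite Er; split=> // i im; apply/eqP; rewrite eqn_leq h2 // leqNgt -h1.
by have := sq i; rewrite im; lia.
Qed.

Lemma symsuper_lowest D (x : symsuper) : (1 < D)%N -> x = 0 \/
  exists m, [/\ coef (val x) m != 0, admissible m &
    forall d, coef (val x) d != 0 -> (weight D m <= weight D d)%N].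
Proof.
move=> D1; have [[m xm]|x0] := pselect (exists m, coef (val x) m != 0); last first.
  left; apply/val_inj/superseriesP => m; apply/eqP.
  by apply: contrapT => /negP h; apply: x0; exists m.
have [d xd low] := exists_lowest D xm; have /asboolP[_ sym] := valP x.
by right; exists d; split=> //; exact: lowest_admissible D1 sym xd low.
Qed.

(** A lowest monomial exists and is admissible, so it is m; no weight has to be computed. *)
Lemma low_term_top D (x : symsuper) m : (1 < D)%N -> coef (val x) m = 1 ->
  (forall d, admissible d -> coef (val x) d != 0 -> d = m) -> low_term D (val x) m.
Proof.
move=> D1 xm uniq_m; have nz : coef (val x) m != 0 by rewrite xm.
have [x0|[d [xd adm low]]] := symsuper_lowest x D1.
  by rewrite x0 sscoef0 eqxx in nz.
have E := uniq_m d adm xd.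
by split; rewrite ?xm ?expr1n // -E.
Qed.

Lemma low_term_e D n : (1 < D)%N -> low_term D (val (sym_e n)) (xrange n, fset0).
Proof.
move=> D1; apply: low_term_top => //; first exact: coef_e_top.
move=> [a I] adm h; have E := coef_t_theta gen_e_theta_bal h; rewrite /= in E.
rewrite {}E in adm h *.
have dg := coef_t_deg gen_e_bal h; rewrite /mdeg cardfs0 addn0 in dg.
have [|/= -> _] := admissible_sqfree adm; last by rewrite dg.
by move=> i; have := gen_e_sqfree i h; rewrite tmon1E tmon_fset0 !in_fset0.
Qed.

(** Degree n + 1, exactly one theta and square-freeness leave a single admissible monomial. *)
Lemma low_term_etilde D n : (1 < D)%N ->
  low_term D (val (sym_etilde n)) (xrange n, [fset n]%fset).
Proof.
move=> D1; apply: low_term_top => //; first exact: coef_etilde_top.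
move=> [a I] adm h; have /= E := coef_ttau_theta gen_e_theta_bal h.
have dg := coef_ttau_deg gen_e_bal h; rewrite /mdeg E addn1 in dg; case: dg => /= dg.
have [|/= Ea EI] := admissible_sqfree adm.
  by move=> i; have := gen_e_sqfree i h; rewrite ttaumon1E ttaumon2E.
rewrite {1}Ea dg; congr pair; rewrite dg in EI; apply/eqP.
rewrite eqEfcard E cardfs1 leqnn andbT; apply/fsubsetP => i /EI ->.
by rewrite inE.
Qed.

Lemma sscoefMz f (c : int) m : coef (f *~ c) m = coef f m * c.
Proof.
have nat_case n : coef (f *+ n) m = coef f m * n%:Z.
  elim: n => [|n IH]; first by rewrite mulr0n mulr0.
  by rewrite mulrS sscoefD IH; lia.
by case: c => n; rewrite ?NegzE ?mulrNz ?sscoefN -pmulrn nat_case ?mulrN.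
Qed.

End Supports.

(** * Generation of the ring by the e_n and etilde_n, as an induction principle for a predicate P *)

Section Generation.
Implicit Types (m d : supermon) (x y : symsuper).
Variable P : symsuper -> Prop.
Hypothesis P1 : P 1.
Hypothesis PB : forall x y, P x -> P y -> P (x - y).
Hypothesis PM : forall x y, P x -> P y -> P (x * y).
Hypothesis Pe : forall n, (1 <= n)%N -> P (sym_e n).
Hypothesis Pet : forall n, P (sym_etilde n).

(** Induction on the degree: with r the first index absent from the x-part, split off etilde_r if
    theta_r occurs and e_r otherwise; the quotient stays admissible. Homogeneity of the product is
    recorded to control degrees during elimination. *)
Lemma exists_low_term D m : admissible m -> ((mdeg m).*2 < D)%N -> (1 < D)%N ->
  exists x, [/\ P x, low_term D (val x) m &
                forall d, coef (val x) d != 0 -> mdeg d = mdeg m].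
Proof.
have [k] := ubnP (mdeg m); elim: k m => // k IH m mk adm mD D1.
have step q g : P g -> low_term D (val g) q -> mdvd q m -> (0 < mdeg q)%N ->
    (forall d, coef (val g) d != 0 -> mdeg d = mdeg q) -> admissible (mquo m q) ->
    exists x, [/\ P x, low_term D (val x) m &
                  forall d, coef (val x) d != 0 -> mdeg d = mdeg m].
  move=> Pg lg qm q0 sg admq; have E := mdeg_quo qm.
  have [||||y [Py ly sy]] := IH (mquo m q); rewrite //; try lia.
  exists (g * y); split; first exact: PM.
    exact: low_termM lg ly.
  move=> d /sscoefM_neq0[c cd /andP[/sg h1 /sy h2]].
  by rewrite (mdeg_quo cd) h1 h2.
have [r [h1 h2]] := admissible_support adm.
have [rI|rI] := boolP (r \in m.2).
  apply: (step (xrange r, [fset r]%fset) (sym_etilde r)) => //.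
  - exact: low_term_etilde.
  - apply/mdvdP; split=> i /=; first by rewrite xrangeE -h1; case: (m.1 i).
    by rewrite inE => /eqP ->.
  - by rewrite /mdeg cardfs1 addn1.
  - move=> d /(coef_ttau_deg gen_e_bal) ->.
    by rewrite /mdeg cardfs1 size_xrange addn1.
  - move=> i; rewrite !mquo1E in_mquo !xrangeE in_fset1.
    have := adm i; have := h1 i; have := h1 i.+1; have := h2 i.+1.
    case: (i.+1 \in m.2); rewrite ?andbF ?andbT; last by lia.
    by case: eqP; lia.
(* For r = 0 no x occurs, and the only possible theta, of index 0, is excluded by [rI]. *)
have [r0|r0] := posnP r.
  suff -> : m = mon1.
    exists 1; split=> //; first exact: low_term1.
    by move=> d; have [->|] := eqVneq d mon1 => //; rewrite [coef _ _]sscoef1 => /negPf ->.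
  apply: digit_eq => i; rewrite /digit mon1_1E mon1_2E.
  have := h1 i; have := h2 i; rewrite r0 ltn0.
  case: (boolP (i \in m.2)) => [im|_]; last by lia.
  move=> /(_ isT); rewrite leqn0 => /eqP i0; move: im rI; rewrite i0 r0 => ->.
  by [].
apply: (step (xrange r, fset0) (sym_e r)) => //; first exact: Pe.
- exact: low_term_e.
- apply/mdvdP; split=> i /=; first by rewrite xrangeE -h1; case: (m.1 i).
  by rewrite in_fset0.
- by rewrite /mdeg size_xrange cardfs0 addn0.
- move=> d /(coef_t_deg gen_e_bal) ->.
  by rewrite /mdeg cardfs0 size_xrange addn0.
- move=> i; rewrite !mquo1E in_mquo !xrangeE in_fset0 /=.
  have := adm i; have := h1 i; have := h1 i.+1; have := h2 i.+1.
  (* At i + 1 = r only a_i drops, but a_r = 0 and theta_r is absent. Elsewhere both exponents drop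
     or both stay. *)
  have [ir|ir] := eqVneq i.+1 r.
    rewrite ir (negPf rI) ltnn -ir ltnSn => _.
    by case: (m.1 i.+1) => // _; case: (m.1 i).
  move/eqP: ir; move: (m.1 i.+1) (m.1 i) => a b.
  by case: (i.+1 \in m.2); lia.
Qed.

Lemma closedMz x (c : int) : P x -> P (x *~ c).
Proof.
move=> Px; have P0 : P 0 by rewrite -(subrr 1); apply: PB.
have PN y : P y -> P (- y) by rewrite -(sub0r y); apply: PB.
have Pn n : P (x *+ n).
  elim: n => [|n IH]; first by rewrite mulr0n.
  by rewrite mulrS -[x *+ n]opprK; apply: PB => //; apply: PN.
by case: c => n; rewrite ?NegzE ?mulrNz -pmulrn; [|apply: PN].
Qed.

(** Induction on a bound k for the distance from the weights in x up to D^N; cancelling the lowest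
    term lowers this bound and keeps the degree at most N. *)
Theorem symsuper_generated x : P x.
Proof.
have /asboolP[[N bN] _] := valP x.
(* D exceeds twice every degree in x, as [weight_inj] requires, and exceeds 1 even for N = 0. *)
have [D [D1 ND]] : exists D, (1 < D /\ N.*2 < D)%N by exists N.+1.*2; lia.
have : forall d, coef (val x) d != 0 -> (D ^ N <= weight D d + D ^ N)%N.
  by move=> d _; exact: leq_addl.
have : forall d, coef (val x) d != 0 -> (mdeg d <= N)%N.
  by move=> d; apply: contraNT; rewrite -ltnNge => /bN ->.
(* Only the summand next to the weight becomes k. For k = 0 every weight is at least D^N, which an
   admissible lowest monomial contradicts. *)
move: {2}(D ^ N)%N => k; elim: k x {bN} => [|k IH] x bN wk;
  have [->|[m [xm adm low]]] := symsuper_lowest x D1;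
  try by rewrite -(subrr 1); apply: PB.
  by have := wk m xm; rewrite addn0 leqNgt (weight_admissible adm (bN m xm) ND).
have mN := bN m xm.
have [|g [Pg [gm lg] sg]] := exists_low_term adm _ D1; first by lia.
(* The coefficient of g at m squares to 1, so c times g has the same coefficient at m as x. *)
pose c := coef (val x) m * coef (val g) m.
have Ec d : coef (val (x - g *~ c)) d = coef (val x) d - coef (val g) d * c.
  by rewrite raddfB raddfMz sscoefD sscoefN sscoefMz.
suff Py : P (x - g *~ c).
  have <- : x - g *~ c - g *~ (- c) = x by rewrite mulrNz opprK subrK.
  by apply: PB => //; apply: closedMz.
have nz d : coef (val (x - g *~ c)) d != 0 ->
    coef (val x) d != 0 \/ coef (val g) d != 0.
  rewrite Ec => h; have [x0|] := eqVneq (coef (val x) d) 0; last by left.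
  by right; apply: contraNneq h => ->; rewrite x0 mul0r subr0.
have deg d : coef (val (x - g *~ c)) d != 0 -> (mdeg d <= N)%N.
  by case/nz => [/bN|/sg ->].
apply: IH => // d hd.
have le : (weight D m <= weight D d)%N by case: (nz d hd) => [/low|/lg].
(* Equal weights would force d = m, where the coefficient has been cancelled. *)
have : weight D m != weight D d.
  have dN := deg d hd; apply: contraNneq hd => /weight_inj E.
  rewrite -E; [|by lia|by lia].
  by rewrite Ec /c mulrCA -expr2 gm mulr1 subrr.
by have := wk m xm; lia.
Qed.

End Generation.

(** * Coefficients of t^n and t^n tau in a product *)

Section Convolution.
Implicit Types (m d c : supermon) (f g F G : superseries) (n k i : nat).

(** Discards t and tau and shifts the other indices back, so that each monomial is recovered as a
    [tmon] or a [ttaumon]. *)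
Definition unshift c : supermon :=
  (seq_mset [seq i.-1 | i <- c.1 & i != 0%N],
   [fset i.-1 | i in c.2 & i != 0%N]%fset).

Lemma unshift1E c i : (unshift c).1 i = c.1 i.+1.
Proof.
rewrite mset_seqE count_map count_filter -count_mem_mset; apply: eq_count => -[|j] /=.
  by rewrite andbF.
by rewrite andbT eqSS.
Qed.

Lemma unshift2E c i : (i \in (unshift c).2) = (i.+1 \in c.2).
Proof.
apply/imfsetP/idP => [[[|j] /=]|h]; rewrite ?inE ?andbF //.
  by rewrite andbT => jc ->.
by exists i.+1; rewrite //= inE h.
Qed.

Lemma tmon_unshift c : 0%N \notin c.2 -> tmon (c.1 0%N) (unshift c) = c.
Proof.
move=> c0; apply: monP => -[|i]; rewrite ?tmon1E ?mmapS2 ?unshift1E ?unshift2E //.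
by rewrite (negPf c0).
Qed.

Lemma ttaumon_unshift c : 0%N \in c.2 -> ttaumon (c.1 0%N) (unshift c) = c.
Proof.
by move=> c0; apply: monP => -[|i];
  rewrite ?ttaumon1E ?ttaumon2E ?unshift1E ?unshift2E ?c0.
Qed.

Lemma tmon_inj k k' d d' : tmon k d = tmon k' d' -> k = k' /\ d = d'.
Proof.
move=> E; split.
  by have := congr1 (fun c : supermon => c.1 0%N) E; rewrite !tmon1E.
apply: monP => i.
  by have := congr1 (fun c : supermon => c.1 i.+1) E; rewrite !tmon1E.
by have := congr1 (fun c : supermon => i.+1 \in c.2) E; rewrite !mmapS2.
Qed.

Lemma ttaumon_inj k k' d d' : ttaumon k d = ttaumon k' d' -> k = k' /\ d = d'.
Proof.
move=> E; split.
  by have := congr1 (fun c : supermon => c.1 0%N) E; rewrite !ttaumon1E.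
apply: monP => i.
  by have := congr1 (fun c : supermon => c.1 i.+1) E; rewrite !ttaumon1E.
by have := congr1 (fun c : supermon => i.+1 \in c.2) E; rewrite !ttaumon2E.
Qed.

Lemma mdvd_tmon k n d m : mdvd (tmon k d) (tmon n m) = (k <= n)%N && mdvd d m.
Proof.
apply/mdvdP/andP => [[h1 h2]|[kn /mdvdP[h1 h2]]].
  split; first by have := h1 0%N; rewrite !tmon1E.
  apply/mdvdP; split=> i; first by have := h1 i.+1; rewrite !tmon1E.
  by have := h2 i.+1; rewrite !mmapS2.
split=> -[|i]; rewrite ?tmon1E ?mmapS2 //; exact: h2.
Qed.

Lemma mdvd_tmon_ttau k n d m : mdvd (tmon k d) (ttaumon n m) = (k <= n)%N && mdvd d m.
Proof.
apply/mdvdP/andP => [[h1 h2]|[kn /mdvdP[h1 h2]]].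
  split; first by have := h1 0%N; rewrite tmon1E ttaumon1E.
  apply/mdvdP; split=> i; first by have := h1 i.+1; rewrite tmon1E ttaumon1E.
  by have := h2 i.+1; rewrite mmapS2 ttaumon2E.
split=> -[|i]; rewrite ?tmon1E ?ttaumon1E ?mmapS2 ?ttaumon2E //; exact: h2.
Qed.

Lemma mdvd_ttaumon k n d m : mdvd (ttaumon k d) (ttaumon n m) = (k <= n)%N && mdvd d m.
Proof.
apply/mdvdP/andP => [[h1 h2]|[kn /mdvdP[h1 h2]]].
  split; first by have := h1 0%N; rewrite !ttaumon1E.
  apply/mdvdP; split=> i; first by have := h1 i.+1; rewrite !ttaumon1E.
  by have := h2 i.+1; rewrite !ttaumon2E.
split=> -[|i]; rewrite ?ttaumon1E ?ttaumon2E //; exact: h2.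
Qed.

Lemma mquo_tmon n k m d : mquo (tmon n m) (tmon k d) = tmon (n - k) (mquo m d).
Proof.
apply: monP => -[|i]; rewrite ?mquo1E ?in_mquo ?tmon1E ?mmapS2 //.
  by rewrite mquo1E.
by rewrite in_mquo.
Qed.

Lemma mquo_ttaumon_t n k m d :
  mquo (ttaumon n m) (tmon k d) = ttaumon (n - k) (mquo m d).
Proof.
apply: monP => -[|i]; rewrite ?mquo1E ?in_mquo ?tmon1E ?ttaumon1E ?mmapS2 ?ttaumon2E //.
  by rewrite mquo1E.
by rewrite in_mquo.
Qed.

Lemma mquo_ttaumon n k m d :
  mquo (ttaumon n m) (ttaumon k d) = tmon (n - k) (mquo m d).
Proof.
apply: monP => -[|i]; rewrite ?mquo1E ?in_mquo ?ttaumon1E ?tmon1E ?ttaumon2E ?mmapS2 //.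
  by rewrite mquo1E.
by rewrite in_mquo.
Qed.

Lemma sum_tmon (T : supermon -> int) n m :
  \sum_(c <- mdivs (tmon n m)) T c =
  \sum_(k < n.+1) \sum_(d <- mdivs m) T (tmon k d).
Proof.
pose s := [seq tmon k d | k <- iota 0 n.+1, d <- mdivs m].
rewrite (perm_big s) /=.
  rewrite big_allpairs_dep -(big_mkord xpredT (fun k => \sum_(d <- mdivs m) T (tmon k d))).
  by rewrite /index_iota subn0.
apply: uniq_perm; first exact: fset_uniq.
  apply: allpairs_uniq; [exact: iota_uniq|exact: fset_uniq|].
  by move=> [k d] [k' d'] _ _ /= /tmon_inj[-> ->].
move=> c; rewrite mem_mdivs; apply/idP/allpairsP => [h|[[k d] [kn dm ->]]].
  have c0 : 0%N \notin c.2.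
    by have /mdvdP[_ /(_ 0%N)] := h; rewrite mmapS2 => h'; apply/negP => /h'.
  move: h; rewrite -{1}(tmon_unshift c0) mdvd_tmon => /andP[h1 h2].
  by exists (c.1 0%N, unshift c); rewrite tmon_unshift // mem_iota mem_mdivs.
by move: kn dm; rewrite mem_iota mem_mdivs mdvd_tmon => /andP[_ kn] ->; rewrite andbT.
Qed.

(** A divisor of t^n tau m is t^k d or t^k tau d with k <= n and d dividing m, according to whether
    it contains tau. *)
Lemma sum_ttaumon (T : supermon -> int) n m :
  \sum_(c <- mdivs (ttaumon n m)) T c =
  \sum_(k < n.+1) \sum_(d <- mdivs m) (T (ttaumon k d) + T (tmon k d)).
Proof.
pose s1 := [seq ttaumon k d | k <- iota 0 n.+1, d <- mdivs m].
pose s2 := [seq tmon k d | k <- iota 0 n.+1, d <- mdivs m].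
rewrite (perm_big (s1 ++ s2)) /=.
  have iotaE (U : nat -> int) : \sum_(k <- iota 0 n.+1) U k = \sum_(k < n.+1) U k.
    by rewrite -(big_mkord xpredT) /index_iota subn0.
  rewrite big_cat !big_allpairs_dep.
  under [in RHS]eq_bigr do rewrite big_split.
  by rewrite big_split; congr (_ + _); rewrite iotaE.
have memE c : (c \in s1 ++ s2) = mdvd c (ttaumon n m).
  rewrite mem_cat; apply/orP/idP.
    case=> /allpairsP[[k d] [kn dm ->]]; move: kn dm; rewrite mem_iota mem_mdivs;
      by rewrite ?mdvd_ttaumon ?mdvd_tmon_ttau => /andP[_ kn] ->; rewrite andbT.
  have [c0|c0] := boolP (0%N \in c.2).
    rewrite -{1}(ttaumon_unshift c0) mdvd_ttaumon => /andP[h1 h2].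
    left; apply/allpairsP; exists (c.1 0%N, unshift c).
    by rewrite ttaumon_unshift // mem_iota mem_mdivs.
  rewrite -{1}(tmon_unshift c0) mdvd_tmon_ttau => /andP[h1 h2].
  right; apply/allpairsP; exists (c.1 0%N, unshift c).
  by rewrite tmon_unshift // mem_iota mem_mdivs.
apply: uniq_perm; [exact: fset_uniq| |by move=> c; rewrite mem_mdivs memE].
rewrite cat_uniq; apply/and3P; split.
- apply: allpairs_uniq; [exact: iota_uniq|exact: fset_uniq|].
  by move=> [k d] [k' d'] _ _ /= /ttaumon_inj[-> ->].
- apply/hasPn => c /allpairsP[[k d] /= [_ _ ->]]; apply/negP => /allpairsP[[k' d'] /= [_ _]].
  by move=> /(congr1 (fun c : supermon => 0%N \in c.2)); rewrite mmapS2 ttaumon2E.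
- apply: allpairs_uniq; [exact: iota_uniq|exact: fset_uniq|].
  by move=> [k d] [k' d'] _ _ /= /tmon_inj[-> ->].
Qed.

Lemma crossings_shift (I J : {fset nat}) :
  crossings [fset i.+1 | i in I]%fset [fset i.+1 | i in J]%fset = crossings I J.
Proof.
rewrite /crossings big_imfset /=; last by move=> x y _ _ [].
by apply: eq_bigr => i _; rewrite big_imfset //= => x y _ _ [].
Qed.

Lemma notin_shift (I : {fset nat}) : 0%N \notin [fset i.+1 | i in I]%fset.
Proof. by apply/negP => /imfsetP[]. Qed.

Lemma crossings_shift0l (I J : {fset nat}) :
  crossings (0%N |` [fset i.+1 | i in I])%fset [fset i.+1 | i in J]%fset = crossings I J.
Proof.
rewrite -[RHS]crossings_shift /crossings big_fsetU1 ?notin_shift //=.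
by rewrite [X in (X + _)%N]big1.
Qed.

(** Moving tau to the left of theta_I costs one crossing for each element of I. *)
Lemma crossings_shift0r (I J : {fset nat}) :
  crossings [fset i.+1 | i in I]%fset (0%N |` [fset i.+1 | i in J])%fset =
  (#|` I| + crossings I J)%N.
Proof.
rewrite -[X in (_ + X)%N]crossings_shift /crossings.
under eq_bigr do rewrite big_fsetU1 ?notin_shift //=.
rewrite big_split /=; congr addn.
by rewrite big_imfset /= => [|x y _ _ []] //; rewrite sum1_size.
Qed.

Lemma coef_tM F G n :
  coef_t (F * G) n = \sum_(k < n.+1) coef_t F k * coef_t G (n - k).
Proof.
apply: superseriesP => m; rewrite sscoef_sum [LHS]sum_tmon.
apply: eq_bigr => k _; rewrite sscoefM; apply: eq_bigr => d _.
by rewrite mquo_tmon crossings_shift.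
Qed.

(** In the second term tau passes the coefficient of t^k in F. The hypothesis makes that coefficient
    free of thetas, so no sign appears. *)
Lemma coef_ttauM F G n : supp_in theta_bal F ->
  coef_ttau (F * G) n = \sum_(k < n.+1)
    (coef_ttau F k * coef_t G (n - k) + coef_t F k * coef_ttau G (n - k)).
Proof.
move=> bF; apply: superseriesP => m; rewrite sscoef_sum [LHS]sum_ttaumon.
apply: eq_bigr => k _; rewrite sscoefD !sscoefM -big_split; apply: eq_bigr => d _.
rewrite mquo_ttaumon mquo_ttaumon_t crossings_shift0l; congr (_ + _).
have [F0|Fd] := eqVneq (coef (coef_t F k) d) 0.
  by rewrite F0 (F0 : coef F (tmon k d) = 0) !mul0r !mulr0.
by rewrite crossings_shift0r (coef_t_theta bF Fd) cardfs0.
Qed.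

End Convolution.

(** * The identity E(-t,-tau) H(t,tau) = 1 *)

Section Twist.
Implicit Types (m d c : supermon) (f g : superseries) (n k i : nat).

Definition tdeg m := (m.1 0 + (0 \in m.2))%N.

(* The substitution t := -t, tau := -tau. *)
Definition twist f := SuperSeries (fun m => (-1) ^+ tdeg m * coef f m).

Lemma coef_twist f m : coef (twist f) m = (-1) ^+ tdeg m * coef f m.
Proof. by []. Qed.

Lemma tdeg_quo d m : mdvd d m -> tdeg m = (tdeg d + tdeg (mquo m d))%N.
Proof.
move=> /mdvdP[/(_ 0%N) h1 /(_ 0%N) h2]; rewrite /tdeg mquo1E in_mquo.
rewrite addnACA subnKC //; congr (_ + _)%N.
by case: (0%N \in d.2) h2 => [/(_ isT) ->|_].
Qed.

Lemma tdeg_mon1 : tdeg mon1 = 0%N.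
Proof. by rewrite /tdeg mon1_1E mon1_2E. Qed.

Lemma twist1 : twist 1 = 1.
Proof.
apply: superseriesP => m; rewrite coef_twist sscoef1.
by have [->|_] := eqVneq m mon1; rewrite ?mulr0 // tdeg_mon1 mulr1.
Qed.

Lemma twistM f g : twist (f * g) = twist f * twist g.
Proof.
apply: superseriesP => m; rewrite coef_twist !sscoefM mulr_sumr.
apply: eq_big_seq => d; rewrite mem_mdivs => dm.
by rewrite !coef_twist (tdeg_quo dm) exprD mulrCA mulrACA.
Qed.

Lemma twist_efac i : twist (efac i) = 1 - gen_u i.
Proof.
apply: superseriesP => m; rewrite coef_twist efacE (sscoefD 1) [RHS]sscoefD sscoefN mulrDr.
congr (_ + _); first by rewrite -coef_twist twist1.
rewrite coef_gen_u.
have [->|_] := eqVneq m (txmon i).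
  have -> : tdeg (txmon i) = 1%N by rewrite /tdeg txmon1E txmon2E.
  by rewrite expr1 mulN1r.
have [->|_] := eqVneq m (tauthetamon i); last by rewrite addr0 mulr0 oppr0.
have -> : tdeg (tauthetamon i) = 1%N by rewrite /tdeg tauthetamon1E tauthetamon2E.
by rewrite expr1 mulN1r.
Qed.

Lemma twist_prod N : twist (\prod_(i < N) efac i) = \prod_(i < N) (1 - gen_u i).
Proof.
elim: N => [|N IH]; first by rewrite !big_ord0 twist1.
by rewrite !big_ord_recr /= twistM IH twist_efac.
Qed.

Lemma twist_gen_e_theta_bal : supp_in theta_bal (twist gen_e).
Proof. by move=> m hm; rewrite coef_twist gen_e_theta_bal // mulr0. Qed.

(** At a given monomial both infinite products may be cut at a common N. The factors are even, hence
    central, and cancel in pairs. *)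
Lemma twist_gen_eK : twist gen_e * gen_h = 1.
Proof.
apply: superseriesP => m; have [N hN] := involves_bound m.
have bd d : mdvd d m -> forall i, (N <= i)%N -> ~~ involves i.+1 d.
  by move=> dm i /hN; rewrite (involves_quo _ dm) negb_or => /andP[].
rewrite (@eq_coefM _ (\prod_(i < N) (1 - gen_u i)) _ (\prod_(i < N) hfac i)).
- congr coef; elim: N {hN bd} => [|N IH]; first by rewrite !big_ord0 mulr1.
  have ev : supp_in even_mon (1 - gen_u N).
    apply: supp_inD; first exact/supp_in1/even_closed.1.
    exact/supp_inN/gen_u_even.
  rewrite !big_ord_recr /= mulrA -[_ * (1 - _) * _]mulrA (even_comm _ ev) !mulrA.
  by rewrite IH mul1r hfacE divrr // unit_geom // gen_u0.
- move=> d dm; rewrite -twist_prod !coef_twist; congr (_ * _).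
  exact: infprod_coef efac_good (bd d dm).
- by move=> d dm; exact: infprod_coef hfac_good (bd d dm).
Qed.

Lemma sscoef_signM f n m : coef ((-1) ^+ n * f) m = (-1) ^+ n * coef f m.
Proof.
rewrite -signr_odd -[in RHS]signr_odd; case: (odd n); last by rewrite !mul1r.
by rewrite !expr1 !mulN1r.
Qed.

Lemma coef_tE G n m : coef (coef_t G n) m = coef G (tmon n m). Proof. by []. Qed.
Lemma coef_ttauE G n m : coef (coef_ttau G n) m = coef G (ttaumon n m).
Proof. by []. Qed.

Lemma coef_t_twist f n : coef_t (twist f) n = (-1) ^+ n * coef_t f n.
Proof.
apply: superseriesP => m; rewrite sscoef_signM !coef_tE coef_twist.
by rewrite /tdeg tmon1E mmapS2 addn0.
Qed.

Lemma coef_ttau_twist f n : coef_ttau (twist f) n = (-1) ^+ n.+1 * coef_ttau f n.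
Proof.
apply: superseriesP => m; rewrite sscoef_signM !coef_ttauE coef_twist.
by rewrite /tdeg ttaumon1E ttaumon2E addn1.
Qed.

Lemma tmon0_mon1 : tmon 0 mon1 = mon1.
Proof.
apply: monP => -[|i]; first by rewrite tmon1E mon1_1E.
- by rewrite tmon1E !mon1_1E.
- by rewrite mmapS2 mon1_2E.
- by rewrite mmapS2 !mon1_2E.
Qed.

Lemma coef_t1 n : coef_t 1 n = (n == 0)%:R.
Proof.
apply: superseriesP => m; rewrite coef_tE sscoef1.
case: n => [|n]; last first.
  have /negPf -> // : tmon n.+1 m != mon1.
  apply/eqP => /(congr1 (fun c : supermon => c.1 0%N)).
  by rewrite tmon1E mon1_1E.
rewrite eqxx mulr1n sscoef1; have [->|m1] := eqVneq m mon1.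
  by rewrite tmon0_mon1 eqxx.
have /negPf -> // : tmon 0 m != mon1.
by apply: contra_neq m1; rewrite -{1}tmon0_mon1 => /tmon_inj[].
Qed.

Lemma coef_ttau1 n : coef_ttau 1 n = 0.
Proof.
apply: superseriesP => m; rewrite coef_ttauE sscoef1.
have /negPf -> // : ttaumon n m != mon1.
by apply/eqP => /(congr1 (fun c : supermon => 0%N \in c.2)); rewrite ttaumon2E mon1_2E.
Qed.

(** Balance leaves only the monomial 1 at t^0; as it involves no index, its coefficient can be read
    off the empty product. *)
Lemma coef_t0_infprod F : good F -> supp_in bal (infprod F) -> coef_t (infprod F) 0 = 1.
Proof.
move=> gF bF; apply: superseriesP => m; rewrite sscoef1.
have [->|m1] := eqVneq m mon1; last first.
  by apply: contra_neq_eq m1 => /(coef_t_deg bF)/eqP; rewrite mdeg_eq0 => /eqP.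
transitivity (coef (\prod_(i < 0) F i) mon1); last by rewrite big_ord0 sscoef1 eqxx.
rewrite coef_tE tmon0_mon1; apply: infprod_coef => // i _.
by rewrite /involves in_mset mon1_1E mon1_2E.
Qed.

End Twist.

(** * The relations between (e, etilde) and (h, htilde), and their unique solvability *)

Section Relations.
Implicit Types n k : nat.

Lemma sym_e0 : sym_e 0 = 1.
Proof. exact/val_inj/(coef_t0_infprod efac_good gen_e_bal). Qed.

Lemma sym_h0 : sym_h 0 = 1.
Proof. exact/val_inj/(coef_t0_infprod hfac_good gen_h_bal). Qed.

Lemma coef_t_even G n : supp_in theta_bal G -> supp_in even_mon (coef_t G n).
Proof.
by move=> bG m; apply: contraNeq => /(coef_t_theta bG) E; rewrite /even_mon E cardfs0.
Qed.

Lemma sym_e_comm n (x : symsuper) : sym_e n * x = x * sym_e n.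
Proof. exact/val_inj/even_comm/coef_t_even/gen_e_theta_bal. Qed.

Lemma sym_h_comm n (x : symsuper) : sym_h n * x = x * sym_h n.
Proof. exact/val_inj/even_comm/coef_t_even/gen_h_theta_bal. Qed.

Lemma val_symM (x y : symsuper) : val (x * y) = val x * val y. Proof. by []. Qed.

Lemma val_symB (x y : symsuper) : val (x - y) = val x - val y. Proof. by []. Qed.

Lemma val_symsum n (U : nat -> symsuper) :
  val (\sum_(k < n) U k) = \sum_(k < n) val (U k).
Proof. exact: raddf_sum. Qed.

Lemma val_signM k (x : symsuper) : val ((-1) ^+ k * x) = (-1) ^+ k * val x.
Proof.
rewrite -signr_odd -[in RHS]signr_odd; case: (odd k); last by rewrite !mul1r.
by rewrite !expr1 !mulN1r.
Qed.

Lemma sum_sym_e_h n :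
  \sum_(k < n.+1) (-1) ^+ k * (sym_e k * sym_h (n - k)) = (n == 0)%:R.
Proof.
apply: val_inj; rewrite (val_symsum _ (fun k => (-1) ^+ k * (sym_e k * sym_h (n - k)))) rmorph_nat.
have := congr1 (coef_t^~ n) twist_gen_eK; rewrite coef_tM coef_t1 => <-.
apply: eq_bigr => k _.
by rewrite val_signM val_symM coef_t_twist mulrA.
Qed.

Lemma sum_sym_e_htilde n :
  \sum_(k < n.+1) (-1) ^+ k *
    (sym_e k * sym_htilde (n - k) - sym_etilde k * sym_h (n - k)) = 0.
Proof.
apply: val_inj; rewrite (val_symsum _ (fun k => (-1) ^+ k *
  (sym_e k * sym_htilde (n - k) - sym_etilde k * sym_h (n - k)))).
transitivity (coef_ttau 1 n); last by rewrite coef_ttau1.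
rewrite -twist_gen_eK (coef_ttauM _ _ twist_gen_e_theta_bal).
apply: eq_bigr => k _.
rewrite val_signM val_symB !val_symM coef_t_twist coef_ttau_twist.
(* The coefficient of t^k tau is twisted by (-1)^(k+1), whence the minus sign before etilde. *)
by rewrite mulrBr exprS mulN1r !mulNr addrC !mulrA.
Qed.

(** Since (-1)^(n-k) = (-1)^n (-1)^k, exchanging the two families changes a relation only by a
    global sign. *)
Lemma sum_rev (R : nzRingType) (U : nat -> nat -> R) n :
  \sum_(k < n.+1) (-1) ^+ k * U (n - k)%N k =
  (-1) ^+ n * \sum_(k < n.+1) (-1) ^+ k * U k (n - k)%N.
Proof.
rewrite (reindex_inj rev_ord_inj) mulr_sumr; apply: eq_bigr => k _ /=.
have kn : (k <= n)%N by rewrite -ltnS.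
rewrite subSS subKn // mulrA -exprD -signr_odd -[in RHS]signr_odd.
by congr (_ ^+ nat_of_bool _ * _); rewrite oddB // oddD.
Qed.

(** The term k = 0 is y n, and the others vanish by strong induction. Applied to a difference y of
    two solutions, this gives uniqueness. *)
Lemma alternating_conv_eq0 (R : nzRingType) (a y : nat -> R) : a 0%N = 1 ->
  (forall n, \sum_(k < n.+1) (-1) ^+ k * (a k * y (n - k)%N) = 0) ->
  forall n, y n = 0.
Proof.
move=> a0 h n; have [N] := ubnP n; elim: N n => // N IH n nN.
have := h n; rewrite big_ord_recl big1 => [|k _].
  by rewrite a0 !mul1r subn0 addr0.
rewrite IH ?mulr0 // lift0; have := ltn_ord k; lia.
Qed.

End Relations.

(** * The exchange of the two families by omega, and its extension to the whole ring *)

Theorem theorem20 (omega : {rmorphism symsuper -> symsuper})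
  (omega_e : forall n : nat, (1 <= n)%N -> omega (sym_e n) = sym_h n)
  (omega_etilde : forall n : nat, omega (sym_etilde n) = sym_htilde n) :
  involutive omega /\
  ((forall n : nat, omega (sym_h n) = sym_e n) /\
   (forall n : nat, omega (sym_htilde n) = sym_etilde n)).
Proof.
have oe n : omega (sym_e n) = sym_h n.
  by case: n => [|n]; [rewrite sym_e0 sym_h0 rmorph1|exact: omega_e].
have oh n : omega (sym_h n) = sym_e n.
  apply/eqP; rewrite -subr_eq0; apply/eqP; move: n.
  (* Both omega(h_n) and e_n solve the same recurrence with coefficients h_k: the first by applying
     omega to the even relation, the second by reversing that relation. *)
  apply: (@alternating_conv_eq0 _ sym_h) => [|n]; first exact: sym_h0.
  under eq_bigr do rewrite mulrBr mulrBr.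
  rewrite sumrB.
  have -> : \sum_(k < n.+1) (-1) ^+ k * (sym_h k * omega (sym_h (n - k))) = (n == 0)%:R.
    rewrite -(rmorph_nat omega) -sum_sym_e_h rmorph_sum; apply: eq_bigr => k _.
    by rewrite !rmorphM rmorphXn rmorphN1 oe.
  have -> : \sum_(k < n.+1) (-1) ^+ k * (sym_h k * sym_e (n - k)) = (n == 0)%:R.
    under eq_bigr do rewrite sym_h_comm.
    rewrite (sum_rev (fun i j => sym_e i * sym_h j)) sum_sym_e_h.
    by case: n => [|n]; rewrite ?mul1r ?mulr0.
  by rewrite subrr.
have oht n : omega (sym_htilde n) = sym_etilde n.
  apply/eqP; rewrite -subr_eq0; apply/eqP; move: n.
  apply: (@alternating_conv_eq0 _ sym_h) => [|n]; first exact: sym_h0.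
  have E1 : \sum_(k < n.+1) (-1) ^+ k *
      (sym_h k * omega (sym_htilde (n - k)) - sym_htilde k * sym_e (n - k)) = 0.
    have := congr1 omega (sum_sym_e_htilde n).
    rewrite rmorph_sum rmorph0 => E; rewrite -[RHS]E; apply: eq_bigr => k _.
    by rewrite rmorphM rmorphXn rmorphN1 rmorphB !rmorphM oe oh omega_etilde.
  (* The odd relation read backwards; the factors can be reordered because e_k and h_k are even. *)
  have E2 : \sum_(k < n.+1) (-1) ^+ k *
      (sym_h k * sym_etilde (n - k) - sym_htilde k * sym_e (n - k)) = 0.
    under eq_bigr do rewrite sym_h_comm -sym_e_comm -opprB mulrN.
    rewrite sumrN.
    rewrite (sum_rev (fun i j => sym_e i * sym_htilde j - sym_etilde i * sym_h j)).
    by rewrite sum_sym_e_htilde mulr0 oppr0.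
  (* In the difference of [E1] and [E2] the inhomogeneous terms htilde_k e_(n-k) cancel. *)
  rewrite -[RHS](subrr 0) -[X in _ = X - _]E1 -[X in _ = _ - X]E2 -sumrB; apply: eq_bigr => k _.
  by rewrite -mulrBr opprB addrA subrK -mulrBr.
(* The elements fixed by the square of omega form a subring, so it suffices to check the
   generators. *)
split=> //; apply: symsuper_generated.
- by rewrite !rmorph1.
- by move=> x y hx hy; rewrite !rmorphB hx hy.
- by move=> x y hx hy; rewrite !rmorphM hx hy.
- by move=> n _; rewrite oe oh.
- by move=> n; rewrite omega_etilde oht.
Qed.
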